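(* Let $n\ge1$ and let $\lambda,\mu$ be partitions of $n$, with $l=l(\lambda)$. For $0\le i\le l$ let $\lambda^{[i]}=(\lambda_{i+1},\ldots,\lambda_l)$. Then $$X^\lambda_\mu(t)=\sum_{\{\rho^i\},\{\tau^i\}}\ \prod_{j=1}^{l(\lambda)-1}\frac{(-1)^{l(\rho^{j})}}{z_{\rho^{j}}(t)},$$ where the sum runs over all sequences of $l(\lambda)-1$ pairs of partitions $(\rho^i,\tau^i)$, $i=1,\ldots,l(\lambda)-1$, such that $|\tau^i|\le|\lambda^{[i]}|$, $\tau^i\lhd\tau^{i-1}\cup\rho^{i-1}$ and $\rho^i\vdash|\lambda^{[i]}|-|\tau^i|$, with the convention $\tau^0\cup\rho^0=\mu$.
   Context: Let $V$ be the ring of symmetric functions over $\mathbb Q(t)$, with power sums $p_n$, $p_\lambda=p_{\lambda_1}p_{\lambda_2}\cdots$. For a partition $\lambda$ with $m_i(\lambda)$ parts equal to $i$, put $z_\lambda=\prod_{i\ge1}i^{m_i(\lambda)}m_i(\lambda)!$ and $z_\lambda(t)=z_\lambda/\prod_{i=1}^{l(\lambda)}(1-t^{\lambda_i})$; $l(\lambda)$ is the number of nonzero parts and $|\lambda|$ the weight. Equip $V$ with the bilinear form $\langle p_\lambda,p_\mu\rangle=\delta_{\lambda\mu}z_\lambda(t)$. Define $q_n\in V$ by $\sum_{n\ge0}q_nz^n=\exp\left(\sum_{n\ge1}\frac{1-t^n}{n}p_nz^n\right)$. The Hall-Littlewood functions are $Q_\lambda(t)=\prod_{i<j}\frac{1-R_{ij}}{1-tR_{ij}}\,q_{\lambda_1}\cdots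 q_{\lambda_l}$, where the raising operator $R_{ij}$ raises the $i$-th index by 1 and lowers the $j$-th index by 1, and $P_\lambda(t)=b_\lambda(t)^{-1}Q_\lambda(t)$ with $b_\lambda(t)=\prod_{i\ge1}\prod_{j=1}^{m_i(\lambda)}(1-t^j)$; one has $\langle P_\lambda,Q_\mu\rangle=\delta_{\lambda\mu}$. The Green polynomials $X^\lambda_\mu(t)$ are defined by $p_\mu=\sum_\lambda X^\lambda_\mu(t)P_\lambda(t)$; equivalently $X^\lambda_\mu(t)=\langle Q_\lambda(t),p_\mu\rangle$. A subpartition $\tau\lhd\mu$ of $\mu=(\mu_1,\ldots,\mu_l)$ is $\tau=(\mu_{i_1},\ldots,\mu_{i_s})$ for some $1\le i_1<\cdots<i_s\le l$ (possibly $\emptyset$ or $\mu$). Sums over $\tau\lhd\mu$ run over the $2^{l(\mu)}$ index subsets, i.e. subpartitions are counted with multiplicity. $\tau\cup\rho$ is the partition whose parts are all the parts of $\tau$ and $\rho$ together. An empty product equals 1. *)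

(* Defs.v *)
From HB Require Import structures.
From mathcomp Require Import all_boot all_order all_algebra.
From mathcomp Require Import finmap monalg.

Set Implicit Arguments.
Unset Strict Implicit.
Unset Printing Implicit Defensive.

Import Order.TTheory GRing.Theory Num.Theory.
Local Open Scope ring_scope.

(* Q(t), and the ring of symmetric functions over Q(t), which is the polynomial
   ring Q(t)[p_1, p_2, ...] in the power sums; the variable of index i of
   {cmonom nat} is p_(i+1). *)
Notation Qt := {fraction {poly rat}}.
Notation Sym := {malg Qt[{cmonom nat}]}.

Definition t : Qt := tofrac 'X.

(* Meaningful for n > 0 only. *)
Definition psum (n : nat) : Sym := mkmalgU (ucm n.-1) 1.

Definition is_part (s : seq nat) : bool := sorted geq s && (0%N \notin s).

Definition is_part_of (n : nat) (s : seq nat) : bool :=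
  is_part s && (sumn s == n).

(* A partition of n has at most n parts, all of them at most n. *)
Definition partitions (n : nat) : seq (seq nat) :=
  [seq s <- [seq [seq val i | i <- bseqval b] | b : n.-bseq 'I_n.+1]
     | is_part_of n s].

Lemma partitions_uniq (n : nat) : uniq (partitions n).
Proof.
apply/filter_uniq; rewrite map_inj_uniq ?enum_uniq // => b c /= eq_bc.
exact/val_inj/(inj_map val_inj).
Qed.

Lemma mem_partitions (n : nat) (s : seq nat) :
  (s \in partitions n) = is_part_of n s.
Proof.
rewrite mem_filter; case: (boolP (is_part_of n s)) => //= /andP[/andP[_ s0] /eqP sn].
have sz : (size s <= n)%N.
  rewrite -sn; elim: s s0 {sn} => //= x s IH.
  rewrite inE negb_or => /andP[x0 /IH h].
  by rewrite -add1n leq_add // lt0n eq_sym.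
have le_n x : x \in s -> (x <= n)%N.
  rewrite -sn; elim: s {s0 sn sz} => //= y s IH.
  by rewrite inE => /orP[/eqP->|/IH h]; rewrite ?leq_addr // (leq_trans h) ?leq_addl.
have szo : (size [seq (inord x : 'I_n.+1) | x <- s] <= n)%N by rewrite size_map.
apply/mapP; exists (Bseq szo); rewrite ?mem_enum //=.
rewrite -map_comp -[LHS]map_id; apply/eq_in_map => x /le_n xn /=.
by rewrite inordK.
Qed.

(* One entry for each of the 2 ^ l(mu) sets of indices. *)
Definition subpartitions (mu : seq nat) : seq (seq nat) :=
  [seq mask (m : (size mu).-tuple bool) mu | m : (size mu).-tuple bool].

Definition part_union (tau rho : seq nat) : seq nat := sort geq (tau ++ rho).

Definition mult (la : seq nat) (i : nat) : nat := count_mem i la.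

Definition zee (la : seq nat) : nat :=
  (\prod_(1 <= i < (sumn la).+1) (i ^ mult la i * (mult la i)`!))%N.

Definition zee_t (la : seq nat) : Qt :=
  (zee la)%:R / \prod_(x <- la) (1 - t ^+ x).

Definition b_t (la : seq nat) : Qt :=
  \prod_(1 <= i < (sumn la).+1) \prod_(1 <= j < (mult la i).+1) (1 - t ^+ j).

Definition psum_part (la : seq nat) : Sym := \prod_(x <- la) psum x.

(* Truncation of sum_(m >= 1) (1 - t^m) / m * p_m * z^m at order n. *)
Definition qlog (n : nat) : {poly Sym} :=
  \sum_(1 <= m < n.+1) (((1 - t ^+ m) / m%:R) *: psum m) *: 'X^m.

(* Coefficient of z^n in exp (sum_(m >= 1) (1 - t^m) / m * p_m * z^m): that
   series has no constant term, so neither its terms of order above n nor its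
   powers of exponent above n contribute. *)
Definition q (n : nat) : Sym :=
  \sum_(k < n.+1) (k`!%:R^-1 : Qt) *: (qlog n ^+ k)`_n.

Definition qz (m : int) : Sym := if m is Posz n then q n else 0.

(* Coefficient of R^r in (1 - R) / (1 - t R). *)
Definition raise_coef (r : nat) : Qt :=
  if r is r'.+1 then t ^+ r'.+1 - t ^+ r' else 1.

(* The index in position k of the product over i < j of R_ij ^ (e i j) applied
   to the index sequence la. *)
Definition raise (la : seq nat) (e : 'I_(size la) -> 'I_(size la) -> nat)
    (k : 'I_(size la)) : int :=
  (nth 0%N la k)%:Z + (\sum_(j : 'I_(size la) | k < j) e k j)%N%:Z
                    - (\sum_(i : 'I_(size la) | i < k) e i k)%N%:Z.
Arguments raise : clear implicits.

Definition raised_q (la : seq nat) (e : 'I_(size la) -> 'I_(size la) -> nat) :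
  Sym := \prod_k qz (raise la e k).
Arguments raised_q : clear implicits.

(* The exponents of the R_ij can be bounded in the expansion of the raising
   operator in HL_Q: the other terms have a negative index. *)
Lemma raised_q_eq0 (la : seq nat) (e : 'I_(size la) -> 'I_(size la) -> nat)
    (i j : 'I_(size la)) :
  (i < j)%N -> (sumn la < e i j)%N -> raised_q la e = 0.
Proof.
move=> ij big; case: (boolP [exists k, (raise la e k < 0)%R]) => [/existsP[k]|].
  rewrite /raised_q (bigD1 k) //=; case: (raise la e k) => // m _.
  by rewrite mul0r.
rewrite negb_exists => /forallP ge0; set I := 'I_(size la).
suff: \sum_(k : I | (j <= k)%N) raise la e k < 0.
  by rewrite ltNge sumr_ge0 // => k _; rewrite leNgt ge0.
rewrite /raise sumrB big_split /= -!(big_morph _ PoszD (erefl _)).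
rewrite subr_lt0 -PoszD ltz_nat.
rewrite [X in (_ + X < _)%N](_ : _ =
  \sum_(k : I | j <= k) \sum_(a : I | (j <= a) && (a < k)) e a k)%N; last first.
  rewrite (exchange_big_dep (fun k : I => (j <= k)%N)) /=; last first.
    by move=> a b ja ab; rewrite (leq_trans ja) // ltnW.
  rewrite [RHS](exchange_big_dep (fun k : I => (j <= k)%N)) /=; last first.
    by move=> a b ja /andP[].
  rewrite (exchange_big_dep (fun k : I => (j <= k)%N)) /=; last first.
    by move=> a b ja /andP[].
  apply: eq_bigr => a ja; apply: eq_bigl => b; rewrite ja /=.
  by case: (ltnP a b) => ab; rewrite ?andbF //= (leq_trans ja) // ltnW.
rewrite [X in (_ < X)%N](eq_bigr (fun k : I =>
  \sum_(a : I | (j <= a) && (a < k)) e a k +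
  \sum_(a : I | ~~ (j <= a) && (a < k)) e a k)%N); last first.
  move=> k _; rewrite (bigID (fun a : I => (j <= a)%N)) /=.
  by congr addn; apply: eq_bigl => a; rewrite andbC.
rewrite big_split /= addnC ltn_add2l.
apply: (@leq_ltn_trans (sumn la)).
  rewrite sumnE (big_nth 0%N) big_mkord.
  by rewrite [X in (_ <= X)%N](bigID (fun k : I => (j <= k)%N)) leq_addr.
apply: leq_trans big _.
rewrite (bigD1 j) //= (bigD1 i) /=; last by rewrite -ltnNge ij.
by rewrite -addnA leq_addr.
Qed.

(* prod_(i < j) (1 - R_ij) / (1 - t R_ij) applied to q_la, expanded in powers
   of the R_ij; r gives the exponent of each R_ij, i < j, and is 0 elsewhere. *)
Definition HL_Q (la : seq nat) : Sym :=
  \sum_(r : {ffun 'I_(size la) * 'I_(size la) -> 'I_(sumn la).+1}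
        | [forall i : 'I_(size la), forall j : 'I_(size la),
             (i < j)%N || (r (i, j) == 0%N :> nat)])
    (\prod_(i < size la) \prod_(j < size la | (i < j)%N) raise_coef (r (i, j)))
      *: raised_q la (fun i j => r (i, j)).

Definition HL_P (la : seq nat) : Sym := (b_t la)^-1 *: HL_Q la.

(* X la mu stands for the Green polynomial with upper index la and lower index
   mu; only its values on partitions of the same number matter. *)
Definition is_green (X : seq nat -> seq nat -> Qt) : Prop :=
  forall (n : nat) (mu : seq nat), is_part_of n mu ->
    psum_part mu = \sum_(la <- partitions n) X la mu *: HL_P la.

(* The sequences ((rho^1, tau^1), ..., (rho^(l-1), tau^(l-1))) attached to
   la = (la_1, ..., la_l), where nu is tau^0 \cup rho^0; each one is listed as
   many times as there are choices of index sets for the tau^i. In the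
   recursive call la' is la^[1], so that la'^[i] = la^[i+1]. *)
Fixpoint pair_seqs (la nu : seq nat) : seq (seq (seq nat * seq nat)) :=
  match la with
  | _ :: (_ :: _) as la' =>
      [seq s | tau <- [seq tau <- subpartitions nu | (sumn tau <= sumn la')%N],
               s <- [seq (rho, tau) :: c | rho <- partitions (sumn la' - sumn tau),
                                           c <- pair_seqs la' (part_union tau rho)]]
  | _ => [:: [::]]
  end.

(* Main.v *)
Require Import Defs.
From HB Require Import structures.
From mathcomp Require Import all_boot all_order all_algebra.
From mathcomp Require Import finmap monalg.
From mathcomp Require Import ring zify.

(** The scalar product <Q_la, p_mu> is computed with the vertex operators of Jing.
    Put Q(z) = sum q_n z^n = exp (sum (1 - t^n)/n p_n z^n), let T(w) and S(u) be
    the ring morphisms p_n |-> p_n + w^n and p_n |-> p_n - u^n, and consider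
      H(z) = sum_n H_n z^n = Q(z) S(1/z),  D(w) = sum_m D_m w^m = Q(1/w)^-1 T(w).
    Since S(u) Q(z) = (1 - u z) / (1 - t u z) Q(z), composing H's reproduces the
    raising operators: Q_la = H_(la_1) ... H_(la_l) 1 ([raise_sum_opHs]). For the
    scalar product D_m is the adjoint of H_m, so <Q_la, f> has to be the constant
    term of D_(la_l) ... D_(la_1) f. The latter, [pairing], is taken as the
    definition, which avoids constructing the scalar product.

    What has to be proved then is that [pairing] is dual to the functions P_mu
    ([pairing_HL_P]). Normal ordering gives the relation ([opDH])
      D_m H_n = (1 - t) [m = n] + sum_(k >= 0) c_k H_(n + k) D_(m + k),
    with sum c_k x^k = (t - x) / (1 - t x). Indices only grow on the right-hand
    side, so D_m kills H_mu 1 when m exceeds all the parts of mu, and dually the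
    constant term of D_(la_l) ... D_(la_1) H_n f is 0 when n exceeds all the parts
    of la. When the largest parts agree, D_m removes one of the r parts equal to m
    with a factor 1 - t^r, and these factors multiply up to b_la(t). By induction
    the pairing of Q_la with Q_mu is delta b_la(t) ([vac_opDs_opHs]), whence
    X^la_mu = pairing la p_mu for any family X with p_mu = sum X^la_mu P_la
    ([green_pairing]).

    It remains to apply the D's to p_mu. T(w) p_mu = prod (p_(mu_i) + w^(mu_i))
    expands over the subpartitions tau of mu, and Q^-1 over the partitions rho,
    with coefficients (-1)^l(rho) / z_rho(t) ([qinv_partitions]). Hence D_(la_1)
    p_mu is the sum of (-1)^l(rho) / z_rho(t) p_(tau cup rho) over the pairs with
    |tau| + |rho| = |la^[1]|, which is the recursion in the statement. The last D
    is followed by the constant term and gives 1, so only l(la) - 1 pairs occur. *)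

Set Implicit Arguments.
Unset Strict Implicit.
Unset Printing Implicit Defensive.

Import Order.TTheory GRing.Theory Num.Theory.
Local Open Scope ring_scope.

(** * Ring morphisms out of the ring of symmetric functions *)

Definition monom_eval (A : comNzRingType) (v : nat -> A) (m : {cmonom nat}) : A :=
  \prod_(i <- finsupp m) v i ^+ m i.

Lemma monom_eval_wide (A : comNzRingType) (v : nat -> A) (m : {cmonom nat})
    (d : {fset nat}) :
  (finsupp m `<=` d)%fset -> monom_eval v m = \prod_(i <- d) v i ^+ m i.
Proof.
move=> le; rewrite /monom_eval (big_fset_incl _ le) // => i id.
by rewrite -cmE_eq0 => /eqP->.
Qed.

Lemma monom_eval_mmorphism (A : comNzRingType) (v : nat -> A) :
  mmorphism (monom_eval v).
Proof.
split; last by rewrite /monom_eval mdom1 big_seq_fset0.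
move=> m1 m2; pose d := (finsupp m1 `|` finsupp m2)%fset.
rewrite !(@monom_eval_wide _ v _ d) ?fsubsetUl ?fsubsetUr ?mdomD //.
by rewrite -big_split; apply: eq_bigr => i _; rewrite cmM exprD.
Qed.

HB.instance Definition _ (A : comNzRingType) (v : nat -> A) :=
  isMultiplicative.Build {cmonom nat} A (monom_eval v) (monom_eval_mmorphism v).

Lemma monom_evalU (A : comNzRingType) (v : nat -> A) i :
  monom_eval v (ucm i) = v i.
Proof. by rewrite /monom_eval mdomU big_seq_fset1 cmUU expr1. Qed.

(** The power sums are free generators. The morphism is packed in a sigma type
    with an opaque proof, so that the morphisms built from it below never
    unfold to sums over supports of monomials. *)
Lemma sym_morphism (A : comNzRingType) (c : {rmorphism Qt -> A}) (v : nat -> A) :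
  {f : {rmorphism Sym -> A} |
    (forall a : Qt, f a%:MP = c a) & (forall k, (0 < k)%N -> f (psum k) = v k)}.
Proof.
exists (mmap c (monom_eval (fun i => v i.+1)) : {rmorphism Sym -> A}); first exact: mmapC.
move=> [|k] // _; rewrite /= mmapU -[RHS]mul1r; congr (_ * _); first exact: rmorph1.
exact: monom_evalU.
Qed.

Lemma malgU_mul (a b : Qt) (m1 m2 : {cmonom nat}) :
  << a *g m1 >> * << b *g m2 >> = << a * b *g mulcm m1 m2 >> :> Sym.
Proof. exact: fgmulUU. Qed.

Lemma malgU_mul1 (m1 m2 : {cmonom nat}) :
  << mulcm m1 m2 >> = << m1 >> * << m2 >> :> Sym.
Proof. rewrite [RHS]malgU_mul (mulr1 (1 : Qt)); reflexivity. Qed.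

Lemma malgU_onecm : << onecm nat >> = 1 :> Sym.
Proof. by []. Qed.

Lemma malgU_exp (m : {cmonom nat}) k :
  << iter k (mulcm m) (onecm nat) >> = << m >> ^+ k :> Sym.
Proof.
elim: k => [|k IH]; first by rewrite malgU_onecm expr0.
by rewrite iterS malgU_mul1 IH exprS.
Qed.

Lemma iter_mulcmE (m : {cmonom nat}) k j : iter k (mulcm m) (onecm nat) j = (k * m j)%N.
Proof. by elim: k => [|k IH] /=; rewrite ?onecmE // mulcmE IH. Qed.

Lemma malg_monomE (m : {cmonom nat}) :
  << m >> = monom_eval (fun i => << ucm i >> : Sym) m.
Proof.
pose P (d : seq nat) := \big[@mulcm nat/onecm nat]_(i <- d)
  iter (m i) (mulcm (ucm i)) (onecm nat).
have PE d : << P d >> = \prod_(i <- d) << ucm i >> ^+ m i :> Sym.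
  rewrite /P; elim: d => [|i d IH]; first by rewrite !big_nil malgU_onecm.
  by rewrite !big_cons malgU_mul1 IH malgU_exp.
have Pc d j : (P d) j = (\sum_(i <- d) m i * (i == j))%N.
  rewrite /P; elim: d => [|i d IH]; first by rewrite !big_nil onecmE.
  by rewrite !big_cons mulcmE IH iter_mulcmE ucmE.
rewrite /monom_eval -PE; congr << _ >>; apply/eqP/cmP => j; rewrite Pc.
case: (boolP (j \in finsupp m)) => jm.
  rewrite (big_fsetD1 j) //= eqxx muln1 big1_seq ?addn0 // => i /=.
  by rewrite !inE => /andP[/negPf-> _]; rewrite muln0.
rewrite big1_seq; first by move: jm; rewrite -cmE_eq0 => /eqP.
by move=> i /= im; case: eqP => // ij; [rewrite -ij im in jm | rewrite muln0].
Qed.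

(** The other half of the freeness of the power sums: identities between ring
    morphisms only have to be checked on constants and power sums. *)
Lemma sym_ext (A : comNzRingType) (f g : {rmorphism Sym -> A}) :
  (forall a : Qt, f a%:MP = g a%:MP) ->
  (forall k, (0 < k)%N -> f (psum k) = g (psum k)) -> f =1 g.
Proof.
move=> fgC fgU x; rewrite (monalgE x) (rmorph_sum f) (rmorph_sum g).
apply: eq_bigr => m _; have -> : << x@_m *g m >> = (x@_m)%:MP * mkmalgU m 1 :> Sym.
  by rewrite [RHS]malgU_mul mul0cm (mulr1 x@_m).
rewrite [LHS](rmorphM f) [RHS](rmorphM g).
congr (_ * _); first exact: fgC.
rewrite malg_monomE /monom_eval.
rewrite (rmorph_prod f) (rmorph_prod g); apply: eq_bigr => i _.
rewrite [LHS](rmorphXn f) [RHS](rmorphXn g); congr (_ ^+ _); exact: (fgU i.+1).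
Qed.

(** * Exponentials as Newton recursions *)

Definition conv (A : nzRingType) (a b : nat -> A) (n : nat) : A :=
  \sum_(i < n.+1) a i * b (n - i)%N.

Section Convolution.

Variable A : comNzRingType.
Implicit Types (a b c x y : nat -> A) (n : nat).

Lemma eq_conv a a' b b' n :
  (forall i, (i <= n)%N -> a i = a' i) -> (forall i, (i <= n)%N -> b i = b' i) ->
  conv a b n = conv a' b' n.
Proof.
move=> ha hb; apply: eq_bigr => i _.
by rewrite ha ?hb ?leq_subr // -ltnS.
Qed.

Lemma convC a b n : conv a b n = conv b a n.
Proof.
rewrite /conv (reindex_inj rev_ord_inj) /=; apply: eq_bigr => i _.
by rewrite subSS subKn 1?mulrC // -ltnS.
Qed.

Lemma coef_conv a b n N : (n < N)%N ->
  ((\poly_(i < N) a i) * (\poly_(i < N) b i))`_n = conv a b n.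
Proof.
move=> nN; rewrite coefM; apply: eq_bigr => i _.
by rewrite !coef_poly !ifT // (leq_ltn_trans _ nN) ?leq_subr // -ltnS.
Qed.

Lemma convA a b c n : conv a (conv b c) n = conv (conv a b) c n.
Proof.
pose P (u : nat -> A) := \poly_(i < n.+1) u i.
have PE u i : (i <= n)%N -> (P u)`_i = u i by move=> h; rewrite coef_poly ltnS h.
transitivity ((P a * (P b * P c))`_n).
  rewrite coefM; apply: eq_bigr => i _.
  by rewrite PE ?coef_conv ?ltnS ?leq_subr // -ltnS.
rewrite mulrA coefM; apply: eq_bigr => i _.
by rewrite PE ?leq_subr // coef_conv.
Qed.

Lemma convDl a b c n : conv (fun i => a i + b i) c n = conv a c n + conv b c n.
Proof. by rewrite /conv -big_split; apply: eq_bigr => i _; rewrite mulrDl. Qed.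

(** With X = sum x_n z^n and E = sum e_n z^n this is z E' = X E and E(0) = 1,
    i.e. E = exp (sum x_n z^n / n). All the exponential series below are handled
    through this recursion, which avoids both infinite series and division. *)
Definition newton x e : Prop :=
  [/\ x 0%N = 0, e 0%N = 1 & forall n, e n *+ n = conv x e n].

(** Enough of characteristic 0 for z E' = X E to determine E; unlike
    invertibility of the integers it passes at once to polynomial rings. *)
Definition nat_regular := forall n (a : A), a *+ n.+1 = 0 -> a = 0.

Lemma newton_uniq x e e' : nat_regular ->
  newton x e -> newton x e' -> e =1 e'.
Proof.
move=> reg [x0 e0 eS] [_ e0' eS'] n.
elim/ltn_ind: n => -[|n] IH; first by rewrite e0 e0'.
apply/eqP; rewrite -subr_eq0; apply/eqP/(reg n).
rewrite mulrnBl eS eS' /conv -sumrB big1 // => -[[|i] /= ltin] _.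
  by rewrite x0 !mul0r subrr.
by rewrite IH ?subrr // ltnS subSS leq_subr.
Qed.

(** exp (f + g) = exp f * exp g: by the Leibniz rule, E F satisfies the
    differential equation of the sum of the exponents. *)
Lemma newton_mul x e y f : newton x e -> newton y f ->
  newton (fun n => x n + y n) (conv e f).
Proof.
move=> [x0 e0 eS] [y0 f0 fS]; split; first by rewrite x0 y0 addr0.
  by rewrite /conv big_ord1 e0 f0 mulr1.
move=> n; rewrite convDl convA.
have -> : conv y (conv e f) n = conv e (conv y f) n.
  rewrite (eq_conv (a' := y) (b' := conv f e)) // => [|i _]; last exact: convC.
  by rewrite convA convC.
rewrite /conv -sumrMnl -big_split /=; apply: eq_bigr => i _.
rewrite -[\sum_(j < i.+1) _](eS i) -[\sum_(j < (n - i).+1) _](fS (n - i)%N).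
by rewrite mulrnAl mulrnAr -mulrnDr subnKC // -ltnS.
Qed.

Lemma newton_dilate (u : A) x e : newton x e ->
  newton (fun n => x n * u ^+ n) (fun n => e n * u ^+ n).
Proof.
move=> [x0 e0 eS]; split; rewrite ?x0 ?mul0r ?e0 ?mul1r // => n.
rewrite -mulrnAl eS /conv mulr_suml; apply: eq_bigr => i _.
by rewrite mulrACA -exprD subnKC // -ltnS.
Qed.

Lemma newton_neg x e f : nat_regular -> newton x e -> newton (fun n => - x n) f ->
  forall n, conv e f n = (n == 0)%:R.
Proof.
move=> reg ne nf; apply: (newton_uniq reg (newton_mul ne nf)); split=> //.
  by case: ne => -> _ _; rewrite subr0.
by move=> [|n] /=; rewrite /conv ?mulr0n big1 ?mul0rn // => i _; rewrite subrr mul0r.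
Qed.

Lemma eq_newton x x' e e' : x =1 x' -> e =1 e' -> newton x e -> newton x' e'.
Proof.
move=> xx ee [x0 e0 eS]; split; rewrite -?xx -?ee // => n.
by rewrite -ee eS; apply: eq_conv => i _.
Qed.

End Convolution.

Lemma newton_map (A B : comNzRingType) (f : {rmorphism A -> B}) x e :
  newton x e -> newton (f \o x) (f \o e).
Proof.
move=> [x0 e0 eS]; split=> /=; rewrite ?x0 ?rmorph0 ?e0 ?rmorph1 // => n.
rewrite -rmorphMn eS /conv rmorph_sum; apply: eq_bigr => i _.
by rewrite rmorphM.
Qed.

(** The three sequences below are the coefficients of (1 - t z) / (1 - z), of its
    inverse (1 - z) / (1 - t z), which is the raising operator series, and of
    (t - z) / (1 - t z). *)
Section ScalarSeries.

Variables (A : comNzRingType) (t : A).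

Definition gcoef (k : nat) : A := if k is 0%N then 1 else 1 - t.

Definition rcoef (k : nat) : A := if k is k'.+1 then t ^+ k'.+1 - t ^+ k' else 1.

Definition ccoef (k : nat) : A := if k is k'.+1 then t ^+ k'.+2 - t ^+ k' else t.

Lemma newton_gcoef : newton (fun k => 1 - t ^+ k) gcoef.
Proof.
split=> //; first by rewrite expr0 subrr.
case=> [|n]; first by rewrite /conv big_ord1 expr0 subrr mul0r.
rewrite /conv big_ord_recl expr0 subrr mul0r add0r.
rewrite big_ord_recr /= subnn mulr1.
rewrite (eq_bigr (fun i : 'I_n => (1 - t ^+ i.+1) * (1 - t))); last first.
  by move=> i _; rewrite /bump /= add1n subSS -subnSK.
elim: n => [|n IH]; first by rewrite big_ord0 add0r expr1.
rewrite mulrS IH [in RHS]big_ord_recr /= /bump /= !add1n.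
move: (\sum_(i < n) _) => z; rewrite !exprS; ring.
Qed.

Lemma newton_rcoef : newton (fun k => t ^+ k - 1) rcoef.
Proof.
split=> //; first by rewrite expr0 subrr.
case=> [|n]; first by rewrite /conv big_ord1 expr0 subrr mul0r.
rewrite /conv big_ord_recl expr0 subrr mul0r add0r big_ord_recr /= subnn mulr1.
have E (i : 'I_n) : (t ^+ bump 0 i - 1) * rcoef (n.+1 - bump 0 i)
    = (t ^+ n.+1 - t ^+ n) + (t ^+ (n - i.+1) - t ^+ (n - i)).
  rewrite /bump /= add1n subSS -[(n - i)%N]subnSK //=.
  have E1 : t ^+ n = t ^+ (n - i.+1) * t ^+ i.+1 by rewrite -exprD subnK.
  by rewrite [t ^+ n.+1]exprS E1 !exprS; ring.
rewrite (eq_bigr _ (fun i _ => E i)) big_split /= sumr_const card_ord.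
rewrite -(big_mkord xpredT (fun i => t ^+ (n - i.+1) - t ^+ (n - i))).
rewrite (@telescope_sumr _ 0 n (fun i => t ^+ (n - i))) // subnn subn0 expr0.
by rewrite /bump /= add1n mulrSr; ring.
Qed.

(** (t - z) / (1 - t z) * (1 - t z) / (1 - z) = (t - z) / (1 - z)
    = 1 - (1 - t) / (1 - z). *)
Lemma conv_ccoef_gcoef n : conv ccoef gcoef n = (if n == 0%N then 1 else 0) - (1 - t).
Proof.
case: n => [|n]; first by rewrite /conv big_ord1 /= mulr1; ring.
rewrite /conv big_ord_recr /= subnn mulr1.
rewrite (eq_bigr (fun i : 'I_n.+1 => ccoef i * (1 - t))); last first.
  by move=> i _; rewrite subSn // -ltnS.
rewrite -mulr_suml.
(* The sum telescopes two terms at a time. *)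
have -> : \sum_(i < n.+1) ccoef i = t ^+ n * (t + 1) - 1.
  elim: n => [|n IH]; first by rewrite big_ord1 expr0 /=; ring.
  by rewrite big_ord_recr /= IH !exprS; ring.
rewrite !exprS; ring.
Qed.

End ScalarSeries.

Lemma nat_regular_poly (A : comNzRingType) : nat_regular A -> nat_regular {poly A}.
Proof.
move=> reg n p pn0; apply/polyP => i; rewrite coef0; apply: (reg n).
by rewrite -coefMn pn0 coef0.
Qed.

Lemma nat_regular_lmod (F : fieldType) (A : comAlgType F) :
  (forall n, n.+1%:R != 0 :> F) -> nat_regular A.
Proof.
move=> char0 n a; rewrite -scaler_nat => an0.
by rewrite -[a]scale1r -(mulVf (char0 n)) -scalerA an0 scaler0.
Qed.

(** If phi translates each exponent x_k by y_k w^k, it multiplies the exponential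
    series E(z) by the scalar series A(w z). This gives the action of the two
    translations p_k |-> p_k + w^k and p_k |-> p_k - u^k on q_n and on the
    coefficients of the inverse series. *)
Lemma newton_translate (A : comNzRingType) (phi : {rmorphism A -> {poly A}})
    (x e y a : nat -> A) :
  nat_regular A -> newton x e -> newton y a ->
  (forall k, phi (x k) = (x k)%:P + (y k)%:P * 'X^k) ->
  forall n, phi (e n) = \poly_(k < n.+1) (a k * e (n - k)%N).
Proof.
move=> reg ne na phix n.
have nP := newton_mul (newton_dilate 'X (newton_map (polyC : {rmorphism _ -> _}) na))
                      (newton_map (polyC : {rmorphism _ -> _}) ne).
have nphi := newton_map phi ne.
have := newton_uniq (nat_regular_poly reg) nphi (eq_newton _ (fun i => erefl) nP).
move=> /(_ _ n) /= ->; last by move=> k /=; rewrite phix addrC.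
rewrite /conv poly_def; apply: eq_bigr => k _ /=.
by rewrite -mul_polyC polyCM mulrAC.
Qed.

Section FormalExp.

Variables (F : fieldType) (A : comAlgType F) (x : nat -> A).
Hypothesis char0 : forall n, n.+1%:R != 0 :> F.
Hypothesis x0 : x 0%N = 0.

(** The truncated logarithm and exponential, at order n; powers of exponent above
    n have no coefficient of order n since the logarithm has no constant term. *)
Definition log_poly n : {poly A} := \sum_(1 <= m < n.+1) (m%:R^-1 *: x m : A) *: 'X^m.

Definition exp_coef n : A := \sum_(k < n.+1) (k`!%:R^-1 : F) *: (log_poly n ^+ k)`_n.

Lemma coef_log_poly n i : (i <= n)%N -> (log_poly n)`_i *+ i = x i.
Proof.
move=> lein; rewrite /log_poly big_add1 big_mkord /= coef_sum.
case: i lein => [|i] lein; first by rewrite mulr0n x0.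
rewrite (bigD1 (Ordinal lein)) //= coefZ coefXn eqxx mulr1 big1 ?addr0; last first.
  move=> j /eqP nj; rewrite coefZ coefXn eqSS; case: eqP => [ij|]; rewrite ?mulr0 //.
  by case: nj; apply: val_inj.
by rewrite -scaler_nat scalerA mulfV ?scale1r.
Qed.

Lemma coef0_log_poly n : (log_poly n)`_0 = 0.
Proof.
rewrite /log_poly big_add1 big_mkord /= coef_sum big1 // => j _.
by rewrite coefZ coefXn mulr0.
Qed.

Lemma coef_log_poly_wide n N i : (i <= n)%N -> (n <= N)%N ->
  (log_poly N)`_i = (log_poly n)`_i.
Proof.
case: i => [|i] lein nN; first by rewrite !coef0_log_poly.
apply/eqP; rewrite -subr_eq0; apply/eqP.
apply: (nat_regular_lmod char0 (n := i)).
by rewrite mulrnBl !coef_log_poly ?subrr // (leq_trans lein).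
Qed.

Lemma eq_coef_exp (P Q : {poly A}) k n :
  (forall i, (i <= n)%N -> P`_i = Q`_i) -> (P ^+ k)`_n = (Q ^+ k)`_n.
Proof.
elim: k n => [|k IH] n PQ; first by rewrite !expr0.
rewrite !exprS !coefM; apply: eq_bigr => i _; rewrite PQ -1?ltnS // IH // => j hj.
by rewrite PQ // (leq_trans hj) ?leq_subr.
Qed.

Lemma coef_exp_lt (P : {poly A}) k n : P`_0 = 0 -> (n < k)%N -> (P ^+ k)`_n = 0.
Proof.
move=> P0; elim: k n => // k IH n nk; rewrite exprS coefM big1 // => -[[|i] ltin] _ /=.
  by rewrite P0 mul0r.
rewrite IH ?mulr0 //; lia.
Qed.

Lemma exp_coef_wide n N K : (n <= N)%N -> (n < K)%N ->
  exp_coef n = \sum_(k < K) (k`!%:R^-1 : F) *: (log_poly N ^+ k)`_n.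
Proof.
move=> nN nK; rewrite /exp_coef.
rewrite (big_ord_widen K (fun k => (k`!%:R^-1 : F) *: (log_poly n ^+ k)`_n)) // big_mkcond.
apply: eq_bigr => k _; case: ltnP => kn.
  by congr (_ *: _); apply: eq_coef_exp => i hi; rewrite (coef_log_poly_wide hi nN).
by rewrite coef_exp_lt ?scaler0 // coef0_log_poly.
Qed.

(** z (L^(k+1))' = (k+1) L^k (z L'), and z L' is the series of x. *)
Lemma coef_log_poly_exp n k :
  (log_poly n ^+ k.+1)`_n *+ n = conv x (fun i => (log_poly n ^+ k)`_i) n *+ k.+1.
Proof.
rewrite /conv; case: n => [|n]; first by rewrite mulr0n big_ord1 x0 mul0r mul0rn.
rewrite -coef_deriv deriv_exp coefMn coefM [in RHS]big_ord_recl x0 mul0r add0r; congr (_ *+ _).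
apply: eq_bigr => i _; rewrite coef_deriv coef_log_poly //.
Qed.

Lemma newton_exp_coef : newton x exp_coef.
Proof.
split=> //; first by rewrite /exp_coef big_ord1 expr0 coef1 invr1 scale1r.
case=> [|n]; first by rewrite mulr0n /conv big_ord1 x0 mul0r.
rewrite [exp_coef n.+1]/exp_coef big_ord_recl expr0 coef1 scaler0 add0r -sumrMnl.
rewrite (eq_bigr (fun k : 'I_n.+1 => (k`!%:R^-1 : F) *:
    conv x (fun i => (log_poly n.+1 ^+ k)`_i) n.+1)); last first.
  move=> k _; rewrite scalerMnr lift0 coef_log_poly_exp.
  by rewrite -scaler_nat scalerA factS natrM invfM mulrAC mulVf ?mul1r.
rewrite /conv; under eq_bigr do rewrite scaler_sumr.
rewrite exchange_big /=; apply: eq_bigr => -[[|i] ltin] _ /=.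
  by rewrite x0 mul0r big1 // => k _; rewrite mul0r scaler0.
rewrite (@exp_coef_wide _ n.+1 n.+1) ?leq_subr //; last by lia.
by rewrite mulr_sumr; apply: eq_bigr => k _; rewrite scalerAr.
Qed.

End FormalExp.

(** * The exponential as a sum over partitions *)

Lemma geq_trans : transitive geq.
Proof. by move=> a b c /= h1 h2; apply: leq_trans h2 h1. Qed.

Lemma geq_total : total geq.
Proof. by move=> a b; apply: leq_total. Qed.

Lemma geq_anti : antisymmetric geq.
Proof. by move=> a b /= /anti_leq. Qed.

Lemma perm_part_union s1 s2 : perm_eq (part_union s1 s2) (s1 ++ s2).
Proof. by rewrite /part_union perm_sort. Qed.

Lemma is_part_union s1 s2 : 0%N \notin s1 -> 0%N \notin s2 -> is_part (part_union s1 s2).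
Proof.
move=> z1 z2; rewrite /is_part sort_sorted; last exact: geq_total.
by rewrite (perm_mem (perm_part_union s1 s2)) mem_cat negb_or z1.
Qed.

Lemma perm_sumn s1 s2 : perm_eq s1 s2 -> sumn s1 = sumn s2.
Proof. by move=> p; rewrite !sumnE (perm_big _ p). Qed.

Lemma leq_sumn s x : x \in s -> (x <= sumn s)%N.
Proof.
elim: s => //= y s IH; rewrite inE => /orP[/eqP->|/IH h]; first exact: leq_addr.
exact: leq_trans h (leq_addl _ _).
Qed.

Lemma zee_wide la N : (sumn la < N)%N ->
  zee la = (\prod_(1 <= i < N) (i ^ mult la i * (mult la i)`!))%N.
Proof.
move=> leN; rewrite /zee [RHS](big_cat_nat (n := (sumn la).+1)) //=.
rewrite [X in (_ * X)%N]big1_seq ?muln1 // => i /=; rewrite mem_index_iota => /andP[lti _].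
rewrite /mult (count_memPn _) //; apply/negP => /leq_sumn; lia.
Qed.

Lemma perm_zee s1 s2 : perm_eq s1 s2 -> zee s1 = zee s2.
Proof.
move=> p; rewrite /zee (perm_sumn p); apply: eq_bigr => i _.
by rewrite /mult (permP p).
Qed.

Lemma zee_cons k la : (0 < k)%N ->
  zee (k :: la) = (k * (mult la k).+1 * zee la)%N.
Proof.
move=> k0; pose N := (k + sumn la).+1.
have kN : k \in index_iota 1 N by rewrite mem_index_iota k0 ltnS leq_addr.
rewrite !(@zee_wide _ N) ?ltnS ?leq_addl //.
rewrite !(bigD1_seq k) ?iota_uniq //= mulnA; congr (_ * _)%N.
  by rewrite /mult /= eqxx add1n expnS factS; lia.
by apply: eq_bigr => i ik; rewrite /mult /= eq_sym (negPf ik).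
Qed.

Lemma part_union1_inj k : {in is_part &, injective (part_union [:: k])}.
Proof.
move=> s1 s2 /andP[srt1 _] /andP[srt2 _] eq12.
apply: (sorted_eq geq_trans geq_anti srt1 srt2).
rewrite -(perm_cons k) -[k :: s1]/([:: k] ++ s1) -[k :: s2]/([:: k] ++ s2).
by rewrite perm_sym -(permPl (perm_part_union _ s2)) -eq12 perm_part_union.
Qed.

(** Removing one part k is a bijection from the partitions of n that contain k to
    the partitions of n - k. *)
Lemma perm_partitions_mem n k : (0 < k <= n)%N ->
  perm_eq [seq rho <- partitions n | k \in rho]
          [seq part_union [:: k] sg | sg <- partitions (n - k)].
Proof.
move=> /andP[k0 kn]; apply: uniq_perm.
- exact/filter_uniq/partitions_uniq.
- rewrite map_inj_in_uniq ?partitions_uniq // => s1 s2.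
  rewrite !mem_partitions => /andP[p1 _] /andP[p2 _]; exact: part_union1_inj.
move=> rho; rewrite mem_filter mem_partitions; apply/idP/mapP.
  move=> /andP[krho /andP[/andP[srt z] /eqP sum_rho]].
  have p := perm_to_rem krho; exists (rem k rho).
    rewrite mem_partitions /is_part_of /is_part (subseq_sorted geq_trans (rem_subseq k rho) srt).
    rewrite (contra (@mem_subseq _ _ _ (rem_subseq k rho) 0%N)) //=.
    by rewrite -sum_rho (perm_sumn p) /= addKn.
  apply: (sorted_eq geq_trans geq_anti srt); first exact: (sort_sorted geq_total).
  by rewrite (permPl p) perm_sym perm_part_union.
move=> [sg]; rewrite mem_partitions => /andP[/andP[_ z] /eqP sum_sg] ->.
rewrite (perm_mem (perm_part_union _ _)) mem_head /is_part_of is_part_union //.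
  by rewrite (perm_sumn (perm_part_union _ _)) /= sum_sg subnKC.
by rewrite inE eq_sym -lt0n.
Qed.

Lemma sumn_mult (s : seq nat) N : all (gtn N) s -> sumn s = (\sum_(k < N) k * mult s k)%N.
Proof.
elim: s => [|x s IH] /= => [_|/andP[xN /IH ->]].
  by rewrite big1 // => k _; rewrite muln0.
rewrite (bigD1 (Ordinal xN)) //= [RHS](bigD1 (Ordinal xN)) //= /mult /= eqxx.
rewrite add1n mulnS -addnA; congr (_ + (_ + _))%N; apply: eq_bigr => i ix.
by have -> : (x == i) = false by apply/negbTE; apply: contra ix => /eqP xi; apply/eqP/val_inj.
Qed.

Section PartitionSum.

Variables (F : fieldType) (A : comAlgType F) (x : nat -> A).
Hypothesis char0 : forall n, n.+1%:R != 0 :> F.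
Hypothesis x0 : x 0%N = 0.

Definition part_sum n : A :=
  \sum_(rho <- partitions n) ((zee rho)%:R^-1 : F) *: \prod_(i <- rho) x i.

Lemma partitions0 : partitions 0 = [:: [::]].
Proof.
apply: perm_small_eq => //; apply: uniq_perm; rewrite ?partitions_uniq // => s.
by rewrite mem_partitions inE /is_part_of /is_part; case: s => [|[|k] s] //=; rewrite ?andbF //.
Qed.

(** n = sum_k k m_k(rho) for rho a partition of n, and k m_k(rho) / z_rho is
    1 / z_sigma where sigma is rho with one part k removed: multiplying the sum
    over partitions by n thus produces the recursion. *)
Lemma newton_part_sum : newton x part_sum.
Proof.
split=> // [|n].
  by rewrite /part_sum partitions0 big_seq1 big_nil /zee /= big_geq // invr1 scale1r.
pose G rho : A := ((zee rho)%:R^-1 : F) *: \prod_(i <- rho) x i.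
transitivity (\sum_(k < n.+1) \sum_(rho <- partitions n) G rho *+ (k * mult rho k)).
  rewrite exchange_big /part_sum -sumrMnl !big_seq; apply: eq_bigr => rho.
  rewrite mem_partitions => /andP[_ /eqP sum_rho]; rewrite sumrMnr; congr (_ *+ _).
  rewrite -[LHS]sum_rho; apply: sumn_mult; apply/allP => i /leq_sumn.
  by rewrite sum_rho.
apply: eq_bigr => -[[|k] ltkn] _ /=.
  by rewrite x0 mul0r big1 // => rho _; rewrite mulr0n.
rewrite (bigID (fun rho => k.+1 \in rho)) /= [X in _ + X]big1 ?addr0 => [|rho nk]; last first.
  by rewrite /mult (count_memPn nk) muln0 mulr0n.
rewrite -big_filter (perm_big _ (perm_partitions_mem (k := k.+1) _)) //.
rewrite big_map /part_sum mulr_sumr; apply: eq_bigr => sg _.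
have p := perm_part_union [:: k.+1] sg.
rewrite /G (perm_big _ p) (perm_zee p) /= big_cons zee_cons // /mult (permP p) /= eqxx add1n.
rewrite scalerMnl scalerAr; congr (_ * (_ *: _)).
rewrite -mulr_natr natrM invfM mulrAC mulVf ?mul1r //.
by rewrite -(@prednK (k.+1 * (count_mem k.+1 sg).+1)).
Qed.

End PartitionSum.

(** * Creation and annihilation operators *)

(** The coefficients of z^m E(z). *)
Definition delay (A : nzRingType) (m : nat) (e : nat -> A) (j : nat) : A :=
  if (m <= j)%N then e (j - m)%N else 0.

Section Pairing.

Variable A : comNzRingType.
Implicit Types (P : {poly A}) (phi : nat -> A).

(** The linear form that sends X^i to phi i. The operators below are infinite
    sums that become finite on each element; writing them as linear forms
    applied to a polynomial hides the bounds of these sums. *)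
Definition umbral phi P : A := \sum_(i < size P) phi i * P`_i.

Lemma umbral_wide N phi P : (size P <= N)%N -> umbral phi P = \sum_(i < N) phi i * P`_i.
Proof.
move=> sPN; rewrite /umbral (big_ord_widen N (fun i => phi i * P`_i)) // big_mkcond.
apply: eq_bigr => i _; case: ltnP => // iP.
by rewrite nth_default ?mulr0.
Qed.

Lemma umbralD phi P Q : umbral phi (P + Q) = umbral phi P + umbral phi Q.
Proof.
pose N := maxn (size P) (size Q).
rewrite !(@umbral_wide N) ?leq_maxl ?leq_maxr ?size_polyD // -big_split /=.
by apply: eq_bigr => i _; rewrite coefD mulrDr.
Qed.

Lemma umbral0 phi : umbral phi 0 = 0.
Proof. by rewrite /umbral size_poly0 big_ord0. Qed.

Lemma umbral_sum phi (I : Type) (r : seq I) (p : pred I) (F : I -> {poly A}) :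
  umbral phi (\sum_(i <- r | p i) F i) = \sum_(i <- r | p i) umbral phi (F i).
Proof. exact: (big_morph _ (umbralD phi) (umbral0 phi)). Qed.

Lemma umbralZ phi c P : umbral phi (c *: P) = c * umbral phi P.
Proof.
rewrite (@umbral_wide (size P)) ?size_scale_leq // /umbral big_distrr /=.
by apply: eq_bigr => i _; rewrite coefZ mulrCA.
Qed.

Lemma umbralXn phi k P : umbral phi ('X^k * P) = umbral (fun i => phi (i + k)%N) P.
Proof.
rewrite mulrC (@umbral_wide (k + size P)); last first.
  apply/leq_sizeP => j hj; rewrite coefMXn; case: ltnP => // kj.
  by rewrite nth_default // leq_subRL.
rewrite big_split_ord /= big1 ?add0r => [|i _]; last by rewrite coefMXn ltn_ord mulr0.
by apply: eq_bigr => i _; rewrite coefMXn ltnNge leq_addr /= addKn addnC.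
Qed.

End Pairing.

(** Both sides sum c a * g k * F (a + k) over a + k <= j; the slack a < K lets K
    be chosen once for all j. *)
Lemma sum_triangle (A : comNzRingType) (c g F : nat -> A) j K : (j < K)%N ->
  \sum_(a < K) \sum_(k < j.+1) (if (k + a <= j)%N then c a * g k * F (a + k)%N else 0)
  = \sum_(d < j.+1) conv c g d * F d.
Proof.
move=> jK.
rewrite [RHS](eq_bigr (fun d : 'I_j.+1 => \sum_(a < K | (a < d.+1)%N) c a * g (d - a)%N * F d)); last first.
  move=> d _; rewrite -(big_ord_widen K (fun a => c a * g (d - a)%N * F d)) ?mulr_suml //.
  exact: leq_trans (ltn_ord d) jK.
rewrite [RHS](exchange_big_dep xpredT) //=; apply: eq_bigr => a _.
rewrite -big_mkcond /=; case: (ltnP j a) => ja.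
  by rewrite !big_pred0 // => k; have := ltn_ord k; lia.
pose r := (j - a)%N.
transitivity (\sum_(k < r.+1) c a * g k * F (a + k)%N).
  rewrite (big_ord_widen j.+1 (fun k => c a * g k * F (a + k)%N)) ?ltnS ?leq_subr //.
  by apply: eq_bigl => k; rewrite /r; lia.
have -> : j.+1 = (a + r.+1)%N by rewrite /r; lia.
rewrite big_split_ord /= [X in X + _]big_pred0 ?add0r => [|k].
  by apply: eq_big => k; rewrite ?addKn // ltnS leq_addr.
by have := ltn_ord k; lia.
Qed.

(** In the application T and S are the translations p_k |-> p_k + X^k and
    p_k |-> p_k - X^k, q and e are the coefficients of Q(z) = exp (sum (1 - t^n)/n
    p_n z^n) and of Q(z)^-1. With D(w) = sum D_m w^m and H(z) = sum H_n z^n, the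
    operators below are D(w) = Q(1/w)^-1 T(w) and H(z) = Q(z) S(1/z). They
    are adjoint for the scalar product <p_lambda, p_mu> = delta z_lambda(t). *)
Section Vertex.

Variables (A : comNzRingType) (t : A) (T S : {rmorphism A -> {poly A}}).
Variables q e : nat -> A.

Hypothesis Tq : forall n, T (q n) = \poly_(k < n.+1) (gcoef t k * q (n - k)).
Hypothesis Se : forall n, S (e n) = \poly_(k < n.+1) (gcoef t k * e (n - k)).
Hypothesis qe : forall n, conv q e n = (n == 0)%:R.
Hypothesis STC : forall f i j, (S (T f)`_j)`_i = (T (S f)`_i)`_j.
Hypothesis STK : forall f, \sum_(j < size (T f)) S (T f)`_j * 'X^j = f%:P.

Definition opD m f := umbral (delay m e) (T f).
Definition opH n f := umbral (fun i => q (n + i)) (S f).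

Lemma opD_sum m (I : Type) (r : seq I) (p : pred I) (F : I -> A) :
  opD m (\sum_(i <- r | p i) F i) = \sum_(i <- r | p i) opD m (F i).
Proof. by rewrite /opD rmorph_sum umbral_sum. Qed.

Lemma opH_sum n (I : Type) (r : seq I) (p : pred I) (F : I -> A) :
  opH n (\sum_(i <- r | p i) F i) = \sum_(i <- r | p i) opH n (F i).
Proof. by rewrite /opH rmorph_sum umbral_sum. Qed.

Lemma opDZ m c f : T c = c%:P -> opD m (c * f) = c * opD m f.
Proof. by move=> Tc; rewrite /opD rmorphM Tc mul_polyC umbralZ. Qed.

Lemma opHZ n c f : S c = c%:P -> opH n (c * f) = c * opH n f.
Proof. by move=> Sc; rewrite /opH rmorphM Sc mul_polyC umbralZ. Qed.

Lemma S_delay m j :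
  S (delay m e j) = \poly_(k < j.+1) (gcoef t k * delay m e (j - k)).
Proof.
rewrite /delay; case: leqP => mj; last first.
  rewrite rmorph0; apply/polyP => k; rewrite coef0 coef_poly; case: ifP => // _.
  by rewrite leqNgt (leq_ltn_trans (leq_subr _ _) mj) mulr0.
rewrite Se; apply/polyP => k; rewrite !coef_poly !ltnS leq_subRL //.
case: (leqP (m + k) j) => mk.
  by rewrite (leq_trans _ mk) ?leq_addl // leq_subRL ?(leq_trans (leq_addl _ _) mk) // addnC mk subnAC.
by case: leqP => // kj; rewrite leq_subRL // addnC leqNgt mk mulr0.
Qed.

Lemma opD_qM m p h : opD m (q p * h) =
  \sum_(k < p.+1) gcoef t k * q (p - k) * umbral (fun j => delay m e (j + k)) (T h).
Proof.
rewrite /opD rmorphM Tq poly_def mulr_suml umbral_sum.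
by apply: eq_bigr => k _; rewrite -scalerAl umbralZ umbralXn.
Qed.

Lemma opH_delayM n m j h : opH n (delay m e j * h) =
  \sum_(k < j.+1) gcoef t k * delay m e (j - k) * umbral (fun i => q (n + (i + k))) (S h).
Proof.
rewrite /opH rmorphM S_delay poly_def mulr_suml umbral_sum.
by apply: eq_bigr => k _; rewrite -scalerAl umbralZ umbralXn.
Qed.

Lemma conv_q_delay m N : conv q (delay m e) N = (N == m)%:R.
Proof.
case: (leqP m N) => [mN|Nm]; last first.
  rewrite (ltn_eqF Nm) /conv big1 // => i _.
  by rewrite /delay leqNgt (leq_ltn_trans (leq_subr _ _) Nm) mulr0.
have [r ->] : exists r, N = (m + r)%N by exists (N - m)%N; rewrite subnKC.
rewrite -[X in _ == X]addn0 eqn_add2l -qe /conv addnC -addSn big_split_ord /=.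
rewrite addrC big1 ?add0r => [|i _]; last first.
  by rewrite /delay ifF ?mulr0 //; have := ltn_ord i; lia.
apply: eq_bigr => i _; rewrite /delay ifT; last by have := ltn_ord i; lia.
by congr (_ * e _); have := ltn_ord i; lia.
Qed.

(** The coefficient identity behind the commutation relation. In both sums the
    terms have the form q_i E_(p + j - i), the first sum covering i <= p and the
    second i >= p; since c(z) g(z) = 1 - (1 - t) / (1 - z), the difference has the
    same coefficient 1 - t on every term, and the terms add up to a full
    convolution. *)
Lemma opDH_coef (E : nat -> A) p j :
  \sum_(k < p.+1) gcoef t k * q (p - k) * E (j + k)%N
  - \sum_(d < j.+1) conv (ccoef t) (gcoef t) d * q (p + d) * E (j - d)%N
  = (1 - t) * conv q E (p + j).
Proof.
rewrite /conv -addnS big_split_ord /= -/(conv _ _).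
rewrite big_ord_recl /= mul1r subn0 addn0.
rewrite [\sum_(d < j.+1) _](eq_bigr (fun d : 'I_j.+1 =>
  (if d == ord0 then q p * E j else 0) - (1 - t) * (q (p + d)%N * E (j - d)%N))); last first.
  move=> d _; rewrite -/(conv _ _ d) conv_ccoef_gcoef -[d == ord0]/(nat_of_ord d == 0%N).
  by case: (nat_of_ord d) => [|d'] /=; rewrite ?addn0 ?subn0; ring.
rewrite sumrB -big_mkcond big_pred1_eq /= mulrDr !mulr_sumr.
have -> : \sum_(i < p) gcoef t (bump 0 i) * q (p - bump 0 i) * E (j + bump 0 i)%N
    = \sum_(i < p) (1 - t) * (q i * E (p + j - i)%N).
  rewrite (reindex_inj rev_ord_inj) /=; apply: eq_bigr => i _.
  rewrite /bump /= add1n mulrA; congr (_ * q _ * E _); have := ltn_ord i; lia.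
have -> : \sum_(i < j.+1) (1 - t) * (q (p + i)%N * E (p + j - (p + i))%N) =
    \sum_(i < j.+1) (1 - t) * (q (p + i)%N * E (j - i)%N).
  by apply: eq_bigr => i _; rewrite subnDl.
by rewrite opprB; ring.
Qed.

(** Normal ordering, x = w z: moving T(w) through Q(z) produces
    g(x) = (1 - t x) / (1 - x), and moving S(1/z) through Q(1/w)^-1 produces
    g(1/x). So D(w) H(z) - c(1/x) H(z) D(w), with c(1/x) g(1/x) =
    1 - (1 - t) / (1 - 1/x), is the normally ordered product times (1 - t) times
    the formal delta function sum_(k in Z) x^k. On x = 1 the normally ordered
    product is the identity, as Q Q^-1 = 1 and S is inverse to T. The sum over k
    stops at the degree in w of T(w) f, beyond which D_(m + k) f = 0. *)
Lemma opDH m n f K : (size (T f) <= K)%N ->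
  opD m (opH n f) = (m == n)%:R * (1 - t) * f
    + \sum_(k < K) ccoef t k * opH (n + k) (opD (m + k) f).
Proof.
move=> leK; pose J := size (T f).
pose U j : {poly A} := S (T f)`_j.
(* A common bound for the degrees in u that occur. *)
pose B := maxn (size (S f)) (\max_(j < J) size (U j)).
pose M i j := (S (T f)`_j)`_i.
have sT i : (size (T (S f)`_i : {poly A})%R <= J)%N.
  by apply/leq_sizeP => j hj; rewrite -STC (nth_default 0 hj) rmorph0 coef0.
have sS (j : 'I_J) : (size (U j) <= B)%N.
  by rewrite leq_max (leq_bigmax (F := fun j : 'I_J => size (U j))) ?orbT.
(* Both products are linear in the doubly indexed family M. *)
have DH : opD m (opH n f) = \sum_(i < B) \sum_(j < J)
    (\sum_(k < (n + i).+1) gcoef t k * q (n + i - k) * delay m e (j + k)) * M i j.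
  rewrite /opH (@umbral_wide _ B) ?leq_maxl // opD_sum; apply: eq_bigr => i _.
  rewrite opD_qM.
  under eq_bigr do rewrite (@umbral_wide _ J) // mulr_sumr.
  rewrite exchange_big; apply: eq_bigr => j _; rewrite mulr_suml.
  by apply: eq_bigr => k _; rewrite /M STC mulrA.
have HD : \sum_(k < K) ccoef t k * opH (n + k) (opD (m + k) f) =
    \sum_(i < B) \sum_(j < J) (\sum_(d < j.+1)
      conv (ccoef t) (gcoef t) d * (q (n + i + d) * delay m e (j - d))) * M i j.
  rewrite exchange_big /=.
  transitivity (\sum_(j < J) \sum_(a < K) ccoef t a * opH (n + a) (delay (m + a) e j * (T f)`_j)).
    rewrite exchange_big /=; apply: eq_bigr => a _.
    by rewrite -mulr_sumr -opH_sum.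
  apply: eq_bigr => j _.
  have E (a : 'I_K) : ccoef t a * opH (n + a) (delay (m + a) e j * (T f)`_j) =
      \sum_(i < B) (\sum_(k < j.+1) (if (k + a <= j)%N then ccoef t a * gcoef t k *
        (q (n + i + (a + k)) * delay m e (j - (a + k))) else 0)) * M i j.
    rewrite opH_delayM mulr_sumr.
    under eq_bigr do rewrite (umbral_wide _ (sS j)) !mulr_sumr.
    rewrite exchange_big; apply: eq_bigr => i _; rewrite mulr_suml.
    apply: eq_bigr => k _; rewrite -/(M i j).
    have -> : (n + a + (i + k) = n + i + (a + k))%N by lia.
    have -> : delay (m + a) e (j - k) =
        if (k + a <= j)%N then delay m e (j - (a + k)) else 0.
      rewrite /delay; have := ltn_ord k; case: ifP => h1; case: ifP => h2 //; try lia.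
        by rewrite ifT => [hk|]; [congr e; lia | lia].
      by rewrite ifF //; lia.
    by case: ifP => _; rewrite ?mulr0 ?mul0r ?mulr0 //; ring.
  rewrite (eq_bigr _ (fun a _ => E a)) exchange_big /=; apply: eq_bigr => i _.
  rewrite -mulr_suml (sum_triangle _ _ (fun d => q (n + i + d) * delay m e (j - d))) //.
  exact: leq_trans (ltn_ord j) leK.
rewrite HD; apply/eqP; rewrite -subr_eq DH -sumrB; apply/eqP.
have eqM (i : 'I_B) : \sum_(j < J) (\sum_(k < (n + i).+1) gcoef t k * q (n + i - k) * delay m e (j + k)) * M i j
    - \sum_(j < J) (\sum_(d < j.+1)
      conv (ccoef t) (gcoef t) d * (q (n + i + d) * delay m e (j - d))) * M i j
    = (1 - t) * \sum_(j < J) (n + i + j == m)%:R * M i j.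
  rewrite -sumrB mulr_sumr; apply: eq_bigr => j _; rewrite -mulrBl.
  under [X in _ - X]eq_bigr do rewrite mulrA.
  by rewrite opDH_coef conv_q_delay mulrA.
rewrite (eq_bigr _ (fun i _ => eqM i)) -mulr_sumr mulrAC [RHS]mulrC; congr (_ * _).
have [nm|mn] := leqP n m; last first.
  rewrite (ltn_eqF mn) mul0r big1 // => i _; rewrite big1 // => j _.
  by rewrite [(_ == m)](_ : _ = false) ?mul0r //; lia.
have := congr1 (fun p : {poly A} => p`_(m - n)) (STK f).
rewrite coefC coef_sum -/J => E.
have -> : (m == n)%:R * f = (if (m - n)%N == 0%N then f else 0).
  by rewrite (_ : (m == n) = (m - n == 0)%N); [case: ifP; rewrite ?mul1r ?mul0r | lia].
(* The terms with n + i + j = m form the coefficient of order m - n of S(w) T(w) f. *)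
rewrite -E exchange_big; apply: eq_bigr => j _; rewrite coefMXn.
case: ltnP => hj.
  by rewrite big1 // => i _; rewrite [(_ == m)](_ : _ = false) ?mul0r //; lia.
case: (ltnP (m - n - j) B) => hB.
  rewrite (bigD1 (Ordinal hB)) //= [(_ == m)](_ : _ = true); last by lia.
  rewrite mul1r big1 ?addr0 // => i /eqP ni.
  rewrite [(_ == m)](_ : _ = false) ?mul0r //.
  by apply/negbTE/eqP => h; apply: ni; apply: val_inj => /=; lia.
rewrite nth_default ?(leq_trans (sS j)) // big1 // => i _.
by rewrite [(_ == m)](_ : _ = false) ?mul0r //; have := ltn_ord i; lia.
Qed.

Hypotheses (Tt : T t = t%:P) (St : S t = t%:P).

Variables (B : comNzRingType) (vac : {rmorphism A -> B}).
Hypothesis vac_q : forall n, vac (q n) = (n == 0)%:R.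

(** H_(mu_1) ... H_(mu_k) 1, which will be the Hall-Littlewood function Q_mu. *)
Definition opHs (mu : seq nat) : A := foldr opH 1 mu.

(** D_(la_l) ... D_(la_1) f; its constant term is the scalar product of f with
    Q_la. *)
Definition opDs (la : seq nat) (f : A) : A := foldl (fun g m => opD m g) f la.

Arguments opHs _ : simpl never.
Arguments opDs _ _ : simpl never.

Lemma opHs_cons n mu : opHs (n :: mu) = opH n (opHs mu).
Proof. by []. Qed.

Lemma opDs_cons m la f : opDs (m :: la) f = opDs la (opD m f).
Proof. by []. Qed.

Lemma opDs_sum la (I : Type) (r : seq I) (p : pred I) (F : I -> A) :
  opDs la (\sum_(i <- r | p i) F i) = \sum_(i <- r | p i) opDs la (F i).
Proof.
elim: la F => // m la IH F; rewrite opDs_cons opD_sum IH.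
by apply: eq_bigr => i _; rewrite opDs_cons. Qed.

Lemma opDsZ la c f : T c = c%:P -> opDs la (c * f) = c * opDs la f.
Proof. by move=> Tc; elim: la f => // m la IH f; rewrite !opDs_cons opDZ // IH. Qed.

Lemma opD1 m : (0 < m)%N -> opD m 1 = 0.
Proof.
by move=> m0; rewrite /opD rmorph1 /umbral size_poly1 big_ord1 /delay leqNgt m0 mul0r.
Qed.

(** The commutation relation only raises the index of D, so that D stays larger
    than all the remaining indices until it reaches 1, where it vanishes. *)
Lemma opD_opHs_eq0 m mu : (0 < m)%N -> all (gtn m) mu -> opD m (opHs mu) = 0.
Proof.
elim: mu m => [|n mu IH] m m0 /= => [_|/andP[nm lt_m]]; first exact: opD1.
rewrite opHs_cons (opDH _ _ (leqnn _)) (gtn_eqF nm) !mul0r add0r big1 // => k _.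
rewrite IH; first by rewrite /opH rmorph0 umbral0 mulr0.
  by rewrite addn_gt0 m0.
by apply: sub_all lt_m => x /= xm; rewrite ltn_addr.
Qed.

(** Each of the copies of H_m at the head contributes 1 - t, with a factor t for
    each copy that D_m has crossed before: (1 - t)(1 + t + ... + t^(r - 1)). *)
Lemma opD_opHs_head m mu : (0 < m)%N -> sorted geq (m :: mu) ->
  opD m (opHs (m :: mu)) = (1 - t ^+ (count_mem m mu).+1) * opHs mu.
Proof.
move=> m0; elim: mu => [|n mu IH] srt; rewrite [in LHS]opHs_cons.
  rewrite (opDH _ _ (leqnn _)) eqxx big1 => [|k _]; last first.
    by rewrite opD1 ?addn_gt0 ?m0 // /opH rmorph0 umbral0 mulr0.
  by rewrite /= mul1r addr0 expr1.
have le_m : all (geq m) (n :: mu) by apply: order_path_min geq_trans srt.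
rewrite (opDH _ _ (leqW (leqnn _))) eqxx mul1r big_ord_recl /= !addn0.
rewrite big1 ?addr0 => [|k _]; last first.
  rewrite opD_opHs_eq0; first by rewrite /opH rmorph0 umbral0 mulr0.
    by rewrite addn_gt0 m0.
  by apply: sub_all le_m => x /= xm; rewrite /bump /= addnA addn1 ltn_addr.
have [nm|nm] := eqVneq n m; last first.
  have lt_m : all (gtn m) (n :: mu).
    move: srt => /= /andP[nm' srt]; rewrite ltn_neqAle nm nm' /=.
    have : all (geq n) mu by apply: order_path_min geq_trans srt.
    by apply: sub_all => x /= xn; rewrite (leq_ltn_trans xn) // ltn_neqAle nm.
  rewrite opD_opHs_eq0 // /opH rmorph0 umbral0 mulr0 addr0.
  rewrite (count_memPn _) ?expr1 //; apply/negP => mmu.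
  by have /allP/(_ m) := lt_m; rewrite inE mmu orbT /= ltnn => /(_ isT).
rewrite nm in srt *; rewrite IH; last by case/andP: srt.
rewrite opHZ /=; last by rewrite !(rmorphB, rmorph1, rmorphXn) /= St.
by rewrite -opHs_cons add1n [in RHS]exprS; ring.
Qed.

Lemma vac_opH n f : (0 < n)%N -> vac (opH n f) = 0.
Proof.
move=> n0; rewrite /opH /umbral rmorph_sum big1 // => i _.
by rewrite rmorphM vac_q addn_eq0 (gtn_eqF n0) mul0r.
Qed.

(** The adjoint of the vanishing of D_m on products of H: as H_n moves left its
    index can only grow, and the constant term kills H_n for n > 0. *)
Lemma vac_opDs_opH la n f : (0 < n)%N -> all (gtn n) la ->
  vac (opDs la (opH n f)) = 0.
Proof.
elim: la n f => [|m la IH] n f n0 /=; first by rewrite vac_opH.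
move=> /andP[mn lt_n]; rewrite opDs_cons (opDH _ _ (leqnn _)) (ltn_eqF mn) !mul0r add0r.
rewrite opDs_sum rmorph_sum big1 // => k _.
rewrite opDsZ; last first.
  by case: (nat_of_ord k) => [|k'] //=; rewrite !(rmorphB, rmorphXn) /= Tt.
rewrite rmorphM IH ?mulr0 ?addn_gt0 ?n0 //.
by apply: sub_all lt_n => x /= xm; rewrite ltn_addr.
Qed.

(** b_la(t), read off one part at a time. *)
Fixpoint norm_coef (la : seq nat) : A :=
  if la is a :: la' then (1 - t ^+ (count_mem a la').+1) * norm_coef la' else 1.

(** Orthogonality of the Hall-Littlewood functions: compare the first parts. A
    larger part in la annihilates all the H, a larger part in mu is annihilated
    by all the D, and equal first parts cancel with a factor 1 - t^r. *)
Lemma vac_opDs_opHs la mu : sorted geq la -> sorted geq mu ->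
  0%N \notin la -> 0%N \notin mu -> sumn la = sumn mu ->
  vac (opDs la (opHs mu)) = (la == mu)%:R * vac (norm_coef la).
Proof.
have pos a (s : seq nat) : 0%N \notin a :: s -> (0 < a)%N.
  by rewrite inE negb_or lt0n eq_sym => /andP[].
elim: la mu => [|a la IH] [|b mu] sla smu zla zmu.
- by rewrite /= rmorph1 mulr1.
- by move=> /= h; have := pos _ _ zmu; lia.
- by move=> /= h; have := pos _ _ zla; lia.
have a0 := pos _ _ zla; have b0 := pos _ _ zmu => /= sum_eq.
have [le_a le_b] : all (geq a) la /\ all (geq b) mu.
  by split; [exact: order_path_min geq_trans sla | exact: order_path_min geq_trans smu].
rewrite eqseq_cons; case: (ltngtP a b) => ab /=; last first.
- subst b; rewrite opDs_cons opD_opHs_head // opDsZ; last first.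
    by rewrite !(rmorphB, rmorph1, rmorphXn) /= Tt.
  rewrite !rmorphM IH ?(path_sorted sla) ?(path_sorted smu) //; first last.
  + by move/eqP: sum_eq; rewrite eqn_add2l => /eqP.
  + by move: zmu; rewrite inE negb_or => /andP[].
  + by move: zla; rewrite inE negb_or => /andP[].
  by case: (eqVneq la mu) => [->|_]; rewrite ?mul1r // !mul0r mulr0.
- rewrite mul0r opDs_cons.
  rewrite opD_opHs_eq0 //= ?ab /=; last by apply: sub_all le_b => x /= xb; apply: leq_ltn_trans ab.
  by rewrite -[0](mul0r 1) opDsZ ?rmorph0 // mul0r rmorph0.
- rewrite mul0r opHs_cons.
  rewrite vac_opDs_opH //= ab /=; apply: sub_all le_a => x /= xa.
  exact: leq_ltn_trans ab.
Qed.

End Vertex.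

(** * Raising operators as products of creation operators *)

Lemma big_ord_recl_cond (R : Type) (idx : R) (op : Monoid.law idx) n
    (P : pred 'I_n.+1) (F : 'I_n.+1 -> R) :
  \big[op/idx]_(i | P i) F i =
  op (if P ord0 then F ord0 else idx)
     (\big[op/idx]_(i | P (lift ord0 i)) F (lift ord0 i)).
Proof. by rewrite big_mkcond big_ord_recl -big_mkcond. Qed.

Section Raising.

Variables (A : comNzRingType) (t : A) (S : {rmorphism A -> {poly A}}) (q : nat -> A).

Definition qint (m : int) : A := if m is Posz n then q n else 0.

Definition raise_index n (v : 'I_n -> int) (e : 'I_n -> 'I_n -> nat) (k : 'I_n) : int :=
  v k + (\sum_(j : 'I_n | k < j) e k j)%N%:Z - (\sum_(i : 'I_n | i < k) e i k)%N%:Z.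

(** The exponent matrices of monomials in the raising operators. *)
Definition upper n N (r : {ffun 'I_n * 'I_n -> 'I_N}) : bool :=
  [forall i : 'I_n, forall j : 'I_n, (i < j)%N || (r (i, j) == 0%N :> nat)].

Definition raise_sum n N (v : 'I_n -> int) : A :=
  \sum_(r : {ffun 'I_n * 'I_n -> 'I_N} | upper r)
    (\prod_(i < n) \prod_(j < n | (i < j)%N) rcoef t (r (i, j))) *
    \prod_k qint (raise_index v (fun i j => r (i, j)) k).

Lemma sum_raise_index n (v : 'I_n -> int) e : \sum_k raise_index v e k = \sum_k v k.
Proof.
rewrite /raise_index sumrB big_split /= -addrA -[RHS]addr0; congr (_ + _).
rewrite -!(big_morph _ PoszD (erefl _)).
rewrite [X in _ - Posz X](exchange_big_dep xpredT) //=.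
by apply/eqP; rewrite subr_eq0; apply/eqP; congr Posz; apply: eq_bigr.
Qed.

Lemma qint_neg m : m < 0 -> qint m = 0.
Proof. by case: m. Qed.

Hypothesis St : S t = t%:P.
Hypothesis Sq : forall n, S (q n) = \poly_(k < n.+1) (rcoef t k * q (n - k)).

Lemma S_qint m N : m < Posz N ->
  S (qint m) = \sum_(c < N) (rcoef t c * qint (m - Posz c)) *: 'X^c.
Proof.
case: m => [n|n] mN; last first.
  rewrite rmorph0 big1 // => c _; rewrite qint_neg ?mulr0 ?scale0r //.
  by rewrite (le_lt_trans (y := Negz n)) // gerBl.
rewrite Sq -(poly_def N (fun c => rcoef t c * qint (Posz n - Posz c))).
apply/polyP => k; rewrite !coef_poly.
case: ltnP => kn; first by rewrite ifT; [rewrite subzn | lia].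
by case: ifP => // _; rewrite qint_neg ?mulr0 //; lia.
Qed.

(** S is multiplicative and S(u) q_n = sum_k r_k q_(n - k) u^k, so that H_p in front
    acts as the product over j of the raising series in R_0j. The bound on the
    total degree makes the truncation of c at N harmless, since an entry that
    exceeds the total degree comes with a negative entry, for which both sides
    vanish. *)
Lemma opH_prod n (e : 'I_n -> int) p N : \sum_k e k < Posz N ->
  opH S q p (\prod_k qint (e k)) = \sum_(c : {ffun 'I_n -> 'I_N})
    (\prod_j rcoef t (c j)) * qint (Posz p + (\sum_j c j)%N%:Z) *
    \prod_j qint (e j - Posz (c j)).
Proof.
move=> sN; case: (boolP [exists k, e k < 0]) => [/existsP[k ek]|].
  rewrite (bigD1 k) //= qint_neg // mul0r /opH rmorph0 umbral0 big1 // => c _.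
  rewrite [X in _ * X](bigD1 k) //= qint_neg ?mul0r ?mulr0 //.
  by apply: le_lt_trans ek; rewrite gerBl.
rewrite negb_exists => /forallP ge0.
have eN k : e k < Posz N.
  apply: le_lt_trans sN; rewrite (bigD1 k) //= lerDl sumr_ge0 // => j _.
  by rewrite leNgt ge0.
rewrite /opH rmorph_prod (eq_bigr _ (fun k _ => S_qint (eN k))) bigA_distr_bigA /=.
rewrite umbral_sum; apply: eq_bigr => c _.
rewrite scaler_prod umbralZ.
have -> : \prod_(i < n) 'X^(c i) = 'X^(\sum_i c i) :> {poly A}.
  by rewrite -prodrXr.
rewrite -['X^_](mulr1 'X^_) umbralXn /umbral size_poly1 big_ord1 coef1 mulr1 /= add0n.
by rewrite big_split /= mulrAC.
Qed.

Lemma S_rcoef k : S (rcoef t k) = (rcoef t k)%:P.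
Proof. by case: k => [|k] /=; rewrite !(rmorph1, rmorphB, rmorphXn) /= ?St. Qed.

(** An upper triangular exponent matrix of size n + 1 is its first row together
    with an upper triangular matrix of size n. *)
Definition border n N (cr : {ffun 'I_n -> 'I_N.+1} * {ffun 'I_n * 'I_n -> 'I_N.+1}) :
    {ffun 'I_n.+1 * 'I_n.+1 -> 'I_N.+1} :=
  [ffun p => match unlift ord0 p.1, unlift ord0 p.2 with
             | Some i, Some j => cr.2 (i, j)
             | None, Some j => cr.1 j
             | _, None => ord0
             end].

Definition unborder n N (r : {ffun 'I_n.+1 * 'I_n.+1 -> 'I_N.+1}) :
    {ffun 'I_n -> 'I_N.+1} * {ffun 'I_n * 'I_n -> 'I_N.+1} :=
  ([ffun j => r (ord0, lift ord0 j)], [ffun p => r (lift ord0 p.1, lift ord0 p.2)]).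

Lemma border0l n N cr j : @border n N cr (ord0, lift ord0 j) = cr.1 j.
Proof. by rewrite ffunE /= unlift_none liftK. Qed.

Lemma borderll n N cr i j : @border n N cr (lift ord0 i, lift ord0 j) = cr.2 (i, j).
Proof. by rewrite ffunE /= !liftK. Qed.

Lemma borderl0 n N cr i : @border n N cr (i, ord0) = ord0.
Proof. by rewrite ffunE /= unlift_none; case: unlift. Qed.

Lemma borderK n N : cancel (@border n N) (@unborder n N).
Proof.
case=> c r; congr pair; apply/ffunP; first by move=> j; rewrite ffunE border0l.
by case=> i j; rewrite ffunE borderll.
Qed.

Lemma unborderK n N : {in @upper n.+1 N.+1, cancel (@unborder n N) (@border n N)}.
Proof.
move=> r /forallP up; apply/ffunP => -[i j].
case: (unliftP ord0 j) => [j' ->|->]; last first.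
  rewrite borderl0; apply: val_inj.
  by have /forallP/(_ ord0) := up i; rewrite ltn0 /= => /eqP.
case: (unliftP ord0 i) => [i' ->|->]; first by rewrite borderll ffunE.
by rewrite border0l ffunE.
Qed.

Lemma upper_border n N cr : upper (@border n N cr) = upper cr.2.
Proof.
apply/forallP/forallP => up i; apply/forallP => j.
  by have /forallP/(_ (lift ord0 j)) := up (lift ord0 i); rewrite borderll.
case: (unliftP ord0 j) => [j' ->|->]; last by rewrite borderl0 eqxx orbT.
case: (unliftP ord0 i) => [i' ->|->] //; rewrite borderll.
by have /forallP/(_ j') := up i'.
Qed.

Lemma raise_sum_recl n N (v : 'I_n.+1 -> int) p :
  v ord0 = Posz p -> \sum_k v (lift ord0 k) <= Posz N ->
  raise_sum N.+1 v = opH S q p (raise_sum N.+1 (fun k => v (lift ord0 k))).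
Proof.
move=> v0 vN; rewrite /raise_sum opH_sum.
rewrite (reindex (@border n N)) /=; last first.
  by exists (@unborder n N) => cr; [move=> _; apply: borderK | apply: unborderK].
rewrite (eq_bigl (fun cr => true && upper cr.2)); last by move=> cr; rewrite upper_border.
rewrite -(pair_big xpredT (@upper n N.+1) (fun c r =>
  (\prod_(i < n.+1) \prod_(j < n.+1 | (i < j)%N) rcoef t (border (c, r) (i, j))) *
  \prod_k qint (raise_index v (fun i j => border (c, r) (i, j)) k))) /=.
rewrite exchange_big; apply: eq_bigr => r _.
rewrite opHZ; last first.
  rewrite rmorph_prod rmorph_prod; apply: eq_bigr => i _.
  by rewrite !rmorph_prod; apply: eq_bigr => j _; apply: S_rcoef.
rewrite (@opH_prod _ _ _ N.+1); last by rewrite sum_raise_index; apply: le_lt_trans vN _; rewrite ltz_nat.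
rewrite mulr_sumr; apply: eq_bigr => c _.
rewrite big_ord_recl big_ord_recl_cond /= mul1r.
rewrite (eq_bigr (fun j => rcoef t (c j))) => [|j _]; last by rewrite border0l.
rewrite [X in _ * X * _](eq_bigr (fun i : 'I_n => \prod_(j < n | (i < j)%N) rcoef t (r (i, j)))); last first.
  move=> i _; rewrite big_ord_recl_cond /= mul1r.
  by apply: eq_big => j; rewrite ?borderll.
rewrite -mulrA mulrCA -mulrA; congr (_ * (_ * _)).
rewrite big_ord_recl; congr (_ * _).
  rewrite -[RHS]/(qint (Posz (p + _)%N)) PoszD; congr qint.
  rewrite /raise_index v0 big_ord_recl_cond /= add0n [X in _ - Posz X]big_pred0 // -[RHS]subr0; congr (_ - _).
  by congr (_ + Posz _); apply: eq_bigr => j _; rewrite border0l.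
apply: eq_bigr => k _; congr qint; rewrite /raise_index.
rewrite big_ord_recl_cond /= add0n [X in _ - Posz X]big_ord_recl_cond /=.
rewrite border0l PoszD opprD addrA addrAC; congr (_ + Posz _ - Posz _ - _).
  by apply: eq_big => j; rewrite ?borderll.
by apply: eq_big => j; rewrite ?borderll.
Qed.

(** The expansion of the raising operators does not depend on the bound chosen for
    their exponents, as soon as it is at least the weight: this is what lets the
    induction go through. *)
Lemma raise_sum_opHs (la : seq nat) N : (sumn la <= N)%N ->
  raise_sum N.+1 (fun k : 'I_(size la) => Posz (nth 0%N la k)) = opHs S q la.
Proof.
elim: la => [|m la IH] /= leN.
  rewrite /raise_sum (eq_bigr (fun=> 1)) => [|r _]; last by rewrite !big_ord0 mulr1.
  rewrite (big_pred1 [ffun=> ord0]) // => r.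
  transitivity true; first by apply/forallP => -[].
  by symmetry; apply/eqP/ffunP => -[[]].
rewrite (@raise_sum_recl _ _ _ m) //.
  by rewrite /= IH // (leq_trans _ leN) // leq_addl.
rewrite -(big_morph _ PoszD (erefl _)) /= lez_nat (leq_trans _ leN) //.
by rewrite (leq_trans _ (leq_addl _ _)) // sumnE (big_nth 0%N) big_mkord.
Qed.

End Raising.

(** * The operators on symmetric functions *)

Lemma Qt_char0 n : n.+1%:R != 0 :> Qt.
Proof.
have -> : n.+1%:R = tofrac (n.+1%:R%:P) :> Qt.
  by rewrite polyC_natr rmorph_nat.
by rewrite tofrac_eq0 polyC_eq0 pnatr_eq0.
Qed.

Lemma one_sub_t_neq0 k : (0 < k)%N -> 1 - t ^+ k != 0 :> Qt.
Proof.
move=> k0; have -> : 1 - t ^+ k = tofrac (1 - 'X^k) :> Qt.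
  by rewrite rmorphB rmorph1 rmorphXn.
rewrite tofrac_eq0; apply/negP => /eqP /(congr1 (fun p : {poly rat} => p`_0)).
by rewrite coefB coef1 coefXn coef0 (ltn_eqF k0) subr0 => /eqP; rewrite oner_eq0.
Qed.

Lemma Sym_nat_regular : nat_regular Sym.
Proof. exact: (nat_regular_lmod Qt_char0). Qed.

Definition tS : Sym := t%:MP.

(** Q(z) = exp (sum_n xq_n z^n / n). *)
Definition xq k : Sym := (1 - tS ^+ k) * psum k.

(** The coefficients of Q(z)^-1, given from the start as a sum over partitions,
    the form in which they occur in the formula for the Green polynomials. *)
Definition qinv n : Sym := part_sum (fun k => - xq k) n.

Lemma xq0 : xq 0 = 0.
Proof. by rewrite /xq expr0 subrr mul0r. Qed.

Lemma xqZ k : xq k = (1 - t ^+ k : Qt) *: psum k.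
Proof.
rewrite /xq -[RHS]mul_malgC; congr (_ * _).
by rewrite (rmorphB (@malgC _ _)) (rmorph1 (@malgC _ _)) (rmorphXn (@malgC _ _)).
Qed.

Lemma newton_q : newton xq q.
Proof.
apply: (eq_newton (frefl _) _ (newton_exp_coef Qt_char0 xq0)) => n.
have logE : log_poly xq n = qlog n.
  rewrite /log_poly /qlog; apply: eq_bigr => m _.
  have -> : (m%:R^-1 : Qt) *: xq m = ((1 - t ^+ m) / m%:R : Qt) *: psum m.
    rewrite xqZ scalerA (mulrC (m%:R^-1 : Qt)); reflexivity.
  reflexivity.
rewrite /exp_coef logE; reflexivity.
Qed.

Lemma newton_qinv : newton (fun k => - xq k) qinv.
Proof. by apply: (newton_part_sum Qt_char0); rewrite xq0 oppr0. Qed.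

Lemma conv_q_qinv n : conv q qinv n = (n == 0)%:R.
Proof. exact: (newton_neg Sym_nat_regular newton_q newton_qinv). Qed.

Definition constP : {rmorphism Qt -> {poly Sym}} :=
  (polyC : {rmorphism Sym -> {poly Sym}}) \o (@malgC _ _ : {rmorphism Qt -> Sym}).

Definition shift_up : {rmorphism Sym -> {poly Sym}} :=
  s2val (sym_morphism constP (fun k => (psum k)%:P + 'X^k)).

Definition shift_down : {rmorphism Sym -> {poly Sym}} :=
  s2val (sym_morphism constP (fun k => (psum k)%:P - 'X^k)).

(** The constant term. *)
Definition vac : {rmorphism Sym -> Qt} :=
  s2val (sym_morphism (idfun : {rmorphism Qt -> Qt}) (fun=> 0)).

Lemma shift_up_const a : shift_up a%:MP = (a%:MP)%:P.
Proof. exact: (s2valP (sym_morphism constP (fun k => (psum k)%:P + 'X^k))). Qed.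

Lemma shift_down_const a : shift_down a%:MP = (a%:MP)%:P.
Proof. exact: (s2valP (sym_morphism constP (fun k => (psum k)%:P - 'X^k))). Qed.

Lemma shift_up_psum k : (0 < k)%N -> shift_up (psum k) = (psum k)%:P + 'X^k.
Proof. exact: (s2valP' (sym_morphism constP (fun k => (psum k)%:P + 'X^k))). Qed.

Lemma shift_down_psum k : (0 < k)%N -> shift_down (psum k) = (psum k)%:P - 'X^k.
Proof. exact: (s2valP' (sym_morphism constP (fun k => (psum k)%:P - 'X^k))). Qed.

Lemma vac_const a : vac a%:MP = a.
Proof. exact: (s2valP (sym_morphism (idfun : {rmorphism Qt -> Qt}) (fun=> 0))). Qed.

Lemma vac_psum k : (0 < k)%N -> vac (psum k) = 0.
Proof. exact: (s2valP' (sym_morphism (idfun : {rmorphism Qt -> Qt}) (fun=> 0))). Qed.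

Lemma shift_up_xq k : shift_up (xq k) = (xq k)%:P + (1 - tS ^+ k)%:P * 'X^k.
Proof.
have Tc : shift_up (1 - tS ^+ k) = (1 - tS ^+ k)%:P.
  by rewrite !rmorphB !rmorph1 !rmorphXn /= shift_up_const.
rewrite [shift_up _](rmorphM shift_up) Tc; case: k Tc => [|k] _.
  by rewrite xq0 expr0 subrr !mul0r addr0.
by rewrite shift_up_psum // mulrDr polyCM.
Qed.

Lemma shift_down_xq k : shift_down (xq k) = (xq k)%:P + (tS ^+ k - 1)%:P * 'X^k.
Proof.
have Sc : shift_down (1 - tS ^+ k) = (1 - tS ^+ k)%:P.
  by rewrite !rmorphB !rmorph1 !rmorphXn /= shift_down_const.
rewrite [shift_down _](rmorphM shift_down) Sc; case: k Sc => [|k] _.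
  by rewrite xq0 expr0 subrr !mul0r addr0.
by rewrite shift_down_psum // mulrBr -polyCM -mulNr -polyCN opprB.
Qed.

Lemma shift_up_q n : shift_up (q n) = \poly_(k < n.+1) (gcoef tS k * q (n - k)).
Proof.
exact: (newton_translate Sym_nat_regular newton_q (newton_gcoef tS) shift_up_xq).
Qed.

Lemma shift_down_q n : shift_down (q n) = \poly_(k < n.+1) (rcoef tS k * q (n - k)).
Proof.
exact: (newton_translate Sym_nat_regular newton_q (newton_rcoef tS) shift_down_xq).
Qed.

Lemma shift_down_qinv n : shift_down (qinv n) = \poly_(k < n.+1) (gcoef tS k * qinv (n - k)).
Proof.
apply: (newton_translate Sym_nat_regular newton_qinv (newton_gcoef tS)) => k.
by rewrite [LHS](rmorphN shift_down) shift_down_xq opprD -mulNr -!polyCN opprB.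
Qed.

Lemma translate_swap (A : comNzRingType) (U V : {rmorphism A -> {poly A}}) a k :
  U a = a%:P + 'X^k -> V a = a%:P - 'X^k ->
  map_poly V (U a) = swapXY (map_poly U (V a)).
Proof.
move=> Ua Va; rewrite Ua Va.
have -> : map_poly V (a%:P + 'X^k) = (a%:P - 'X^k)%:P + 'X^k.
  by rewrite [LHS](rmorphD (map_poly V)) /= map_polyC /= map_polyXn Va.
have -> : map_poly U (a%:P - 'X^k) = (a%:P + 'X^k)%:P - 'X^k.
  by rewrite [LHS](rmorphB (map_poly U)) /= map_polyC /= map_polyXn Ua.
have swapB (u v : {poly {poly A}}) : swapXY (u - v) = swapXY u - swapXY v.
  exact: rmorphB.
have swapX : swapXY ('X^k : {poly {poly A}}) = ('X^k)%:P.
  elim: k {Ua Va} => [|k IH]; rewrite ?expr0 ?rmorph1 //.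
  by rewrite !exprS polyCM -IH -swapXY_X; exact: rmorphM.
rewrite swapB swapXY_polyC swapX.
have -> : map_poly polyC (a%:P + 'X^k) = a%:P%:P + 'X^k.
  by rewrite [LHS](rmorphD (map_poly polyC)) /= map_polyC map_polyXn.
by rewrite polyCB addrAC.
Qed.

(** Both composites send p_k to p_k + w^k - u^k; they live in the two iterated
    polynomial rings, which the exchange of the variables identifies. *)
Lemma shift_up_down_comm f i j :
  (shift_down (shift_up f)`_j)`_i = (shift_up (shift_down f)`_i)`_j.
Proof.
pose F : {rmorphism Sym -> {poly {poly Sym}}} := map_poly shift_down \o shift_up.
pose G : {rmorphism Sym -> {poly {poly Sym}}} := @swapXY Sym \o (map_poly shift_up \o shift_down).
have FG : F =1 G.
  apply: sym_ext => [a|k k0] /=.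
    rewrite shift_up_const shift_down_const !map_polyC /=.
    by rewrite shift_up_const shift_down_const swapXY_polyC map_polyC.
  exact: translate_swap (shift_up_psum k0) (shift_down_psum k0).
have := congr1 (fun u : {poly {poly Sym}} => u`_j`_i) (FG f) => /=.
by rewrite coef_swapXY !coef_map.
Qed.

(** At w = u the two translations cancel. *)
Lemma shift_down_upK f : \sum_(j < size (shift_up f)) shift_down (shift_up f)`_j * 'X^j = f%:P.
Proof.
pose cX : commr_rmorph shift_down 'X := fun x => mulrC _ _.
pose F : {rmorphism Sym -> {poly Sym}} := horner_morph cX \o shift_up.
have FC : F =1 (polyC : {rmorphism Sym -> {poly Sym}}).
  apply: sym_ext => [a|k k0] /=.
    by rewrite shift_up_const horner_morphC shift_down_const.
  rewrite shift_up_psum // rmorphD rmorphXn /= horner_morphC horner_morphX.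
  by rewrite shift_down_psum // subrK.
rewrite -[RHS]FC /= /horner_morph (horner_coef_wide (n := size (shift_up f))) ?size_poly //.
by apply: eq_bigr => j _; rewrite coef_map.
Qed.

Lemma shift_up_tS : shift_up tS = tS%:P. Proof. exact: shift_up_const. Qed.

Lemma shift_down_tS : shift_down tS = tS%:P. Proof. exact: shift_down_const. Qed.

Lemma vac_xq k : vac (xq k) = 0.
Proof.
rewrite [LHS](rmorphM vac); case: k => [|k]; last by rewrite vac_psum ?mulr0.
by rewrite expr0 subrr rmorph0 mul0r.
Qed.

Lemma vac_q n : vac (q n) = (n == 0)%:R.
Proof.
have nreg : nat_regular Qt.
  move=> k a /eqP; rewrite -mulr_natr mulf_eq0 (negPf (Qt_char0 k)) orbF.
  by move/eqP.
have nv := newton_map vac newton_q.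
have nd : newton (vac \o xq) (fun k => (k == 0)%:R).
  split=> //=; first exact: vac_xq.
  case=> [|k]; rewrite /= ?mulr0n ?mul0rn /conv big1 // => i _; by rewrite /= vac_xq mul0r.
exact: (newton_uniq nreg nv nd n).
Qed.

Lemma HL_Q_opHs la : HL_Q la = opHs shift_down q la.
Proof.
rewrite -(raise_sum_opHs shift_down_tS shift_down_q (leqnn (sumn la))).
rewrite /HL_Q /raise_sum; apply: eq_big => r //=.
move=> _; rewrite -mul_malgC; congr (_ * _).
have rc k : (raise_coef k)%:MP = rcoef tS k.
  by case: k => [|k] //=; rewrite rmorphB !rmorphXn.
rewrite rmorph_prod; apply: eq_bigr => i _; rewrite rmorph_prod.
by apply: eq_bigr => j _; apply: rc.
Qed.

(** * Orthogonality and Green polynomials *)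

Lemma b_t_cons k la : (0 < k)%N ->
  b_t (k :: la) = (1 - t ^+ (mult la k).+1) * b_t la.
Proof.
move=> k0; pose N := (k + sumn la).+1.
have wide s : (sumn s < N)%N ->
    b_t s = \prod_(1 <= i < N) \prod_(1 <= j < (mult s i).+1) (1 - t ^+ j).
  move=> leN; rewrite /b_t [RHS](big_cat_nat (n := (sumn s).+1)) //=.
  rewrite [X in _ * X]big1_seq ?mulr1 // => i /=; rewrite mem_index_iota => /andP[lti _].
  rewrite /mult (count_memPn _) ?big_geq //; apply/negP => /leq_sumn; lia.
have kN : k \in index_iota 1 N by rewrite mem_index_iota k0 ltnS leq_addr.
rewrite !wide ?ltnS ?leq_addl //.
rewrite (bigD1_seq k) ?iota_uniq //= [in RHS](bigD1_seq k) ?iota_uniq //= mulrA.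
congr (_ * _); first by rewrite eqxx add1n big_nat_recr //= mulrC.
by apply: eq_bigr => i ik; rewrite eq_sym (negPf ik).
Qed.

Lemma b_t_norm_coef la : 0%N \notin la -> b_t la = vac (norm_coef tS la).
Proof.
elim: la => [|a la IH] /=; first by rewrite rmorph1 /b_t big_geq.
rewrite inE negb_or eq_sym -lt0n => /andP[a0 zla].
rewrite b_t_cons // IH // [RHS](rmorphM vac); congr (_ * _).
by rewrite rmorphB rmorph1 rmorphXn /= vac_const.
Qed.

Lemma b_t_neq0 la : b_t la != 0.
Proof.
rewrite /b_t prodf_seq_neq0; apply/allP => i _ /=.
rewrite prodf_seq_neq0; apply/allP => j; rewrite mem_index_iota => /andP[j0 _] /=.
exact: one_sub_t_neq0.
Qed.

(** The scalar product with Q_la, by the adjointness of D and H. *)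
Definition pairing la (f : Sym) : Qt := vac (opDs shift_up qinv la f).

Lemma pairingZ la a f : pairing la (a *: f) = a * pairing la f.
Proof.
rewrite /pairing -[a *: f]mul_malgC opDsZ; last exact: shift_up_const.
by rewrite rmorphM vac_const.
Qed.

Lemma pairing_sum la (I : Type) (r : seq I) (p : pred I) (F : I -> Sym) :
  pairing la (\sum_(i <- r | p i) F i) = \sum_(i <- r | p i) pairing la (F i).
Proof. by rewrite /pairing opDs_sum rmorph_sum. Qed.

Lemma pairing_HL_P n la mu : is_part_of n la -> is_part_of n mu ->
  pairing la (HL_P mu) = (la == mu)%:R.
Proof.
move=> /andP[/andP[sla zla] /eqP suml] /andP[/andP[smu zmu] /eqP summ].
rewrite /HL_P pairingZ HL_Q_opHs /pairing.
rewrite (vac_opDs_opHs shift_up_q shift_down_qinv conv_q_qinv shift_up_down_comm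
  shift_down_upK shift_up_tS shift_down_tS vac_q) ?suml ?summ //.
rewrite -b_t_norm_coef //; case: eqP => [->|_]; last by rewrite mul0r mulr0.
by rewrite mul1r mulVf ?b_t_neq0.
Qed.

(** Pairing the defining expansion of p_mu with Q_la isolates one coefficient. *)
Lemma green_pairing X n la mu : is_green X -> is_part_of n la -> is_part_of n mu ->
  X la mu = pairing la (psum_part mu).
Proof.
move=> hX hla hmu; rewrite (hX n mu hmu) pairing_sum.
transitivity (\sum_(nu <- partitions n) X nu mu * (la == nu)%:R).
  rewrite (bigD1_seq la) ?mem_partitions ?partitions_uniq //.
  rewrite eqxx mulr1 big1 => [|nu nula]; first exact: (esym (addr0 _)).
  by rewrite eq_sym (negPf nula) mulr0.
rewrite !big_seq; apply: eq_bigr => nu; rewrite mem_partitions => hnu.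
by rewrite pairingZ (pairing_HL_P hla hnu).
Qed.

Lemma vac_qinv n : vac (qinv n) = (n == 0)%:R.
Proof.
have -> : (n == 0)%:R = vac (conv q qinv n) :> Qt by rewrite conv_q_qinv rmorph_nat.
transitivity (\sum_(i < n.+1) (i == 0%N :> nat)%:R * vac (qinv (n - i))).
  rewrite big_ord_recl mul1r subn0 big1 ?addr0 // => i _; exact: mul0r.
rewrite /conv (rmorph_sum vac); apply: eq_bigr => i _.
by rewrite [RHS](rmorphM vac) vac_q.
Qed.

Lemma qinv_partitions n :
  qinv n = \sum_(rho <- partitions n) ((-1) ^+ size rho / zee_t rho) *: psum_part rho.
Proof.
rewrite /qinv /part_sum; apply: eq_bigr => rho _.
have -> : \prod_(i <- rho) (- xq i)
    = ((-1) ^+ size rho * \prod_(i <- rho) (1 - t ^+ i) : Qt) *: psum_part rho.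
  rewrite /psum_part; elim: rho => [|k rho IH].
    by rewrite !big_nil expr0 mulr1 scale1r.
  rewrite !big_cons IH xqZ -scaleNr -scalerAl -scalerAr scalerA.
  have -> : - (1 - t ^+ k) * ((-1) ^+ size rho * \prod_(i <- rho) (1 - t ^+ i))
      = (-1) ^+ (size rho).+1 * ((1 - t ^+ k) * \prod_(i <- rho) (1 - t ^+ i)) :> Qt.
    by rewrite exprS mulN1r !mulNr mulrCA.
  reflexivity.
have E (a b c : Qt) : a^-1 * (b * c) = b / (a / c) by rewrite invf_div mulrCA [c / a]mulrC.
rewrite scalerA E; reflexivity.
Qed.

Lemma big_tuple_bool_recl (R : Type) (idx : R) (op : Monoid.com_law idx) n
    (F : seq bool -> R) :
  \big[op/idx]_(m : n.+1.-tuple bool) F m =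
  op (\big[op/idx]_(m : n.-tuple bool) F (true :: m))
     (\big[op/idx]_(m : n.-tuple bool) F (false :: m)).
Proof.
rewrite (reindex (fun p : bool * n.-tuple bool => [tuple of p.1 :: p.2])) /=.
  by rewrite -(pair_big xpredT xpredT (fun b (m : n.-tuple bool) => F (b :: m))) /= big_bool.
exists (fun m : n.+1.-tuple bool => (thead m, [tuple of behead m])) => [[b m]|m] _ /=.
  by congr pair; apply: val_inj.
by apply: val_inj; rewrite /= [in RHS](tuple_eta m).
Qed.

Lemma big_subpartitions_cons (R : Type) (idx : R) (op : Monoid.com_law idx) x mu
    (F : seq nat -> R) :
  \big[op/idx]_(tau <- subpartitions (x :: mu)) F tau =
  op (\big[op/idx]_(tau <- subpartitions mu) F (x :: tau))
     (\big[op/idx]_(tau <- subpartitions mu) F tau).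
Proof.
rewrite /subpartitions !big_image /=.
exact: (big_tuple_bool_recl _ _ (fun m => F (mask m (x :: mu)))).
Qed.

Lemma subpartitions_sub mu tau : tau \in subpartitions mu -> subseq tau mu.
Proof. by move=> /mapP[m _ ->]; apply: mask_subseq. Qed.

Lemma subseq_sumn (s1 s2 : seq nat) : subseq s1 s2 -> (sumn s1 <= sumn s2)%N.
Proof.
elim: s2 s1 => [|y s2 IH] [|x s1] //=; case: eqP => [->|_] /IH; first by rewrite leq_add2l.
by move=> /= h; apply: leq_trans h (leq_addl _ _).
Qed.

(** Expanding prod_i (p_(mu_i) + w^(mu_i)): the index set of the factors in which
    the power sum is chosen is a subpartition. *)
Lemma shift_up_psum_part mu : 0%N \notin mu ->
  shift_up (psum_part mu) = \sum_(tau <- subpartitions mu)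
     psum_part tau *: 'X^(sumn mu - sumn tau).
Proof.
elim: mu => [_|x mu IH].
  rewrite /subpartitions big_image /= (big_pred1 [tuple]) => [|m]; last first.
    by transitivity true => //; symmetry; apply/eqP; apply: tuple0.
  by rewrite /psum_part big_nil (rmorph1 shift_up) subnn expr0 scale1r.
rewrite inE negb_or eq_sym -lt0n => /andP[x0 zmu].
have E tau : psum_part (x :: tau) = psum x * psum_part tau by apply: big_cons.
rewrite E (rmorphM shift_up) shift_up_psum // IH // big_subpartitions_cons mulrDl !mulr_sumr.
congr (_ + _); rewrite !big_seq; apply: eq_bigr => tau /subpartitions_sub/subseq_sumn le_tau.
  by rewrite E -scalerA mul_polyC /= subnDl.
by rewrite -scalerAr -exprD /= addnBA.
Qed.

Lemma opD_psum_part a mu : 0%N \notin mu -> (a <= sumn mu)%N ->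
  opD shift_up qinv a (psum_part mu) =
  \sum_(tau <- subpartitions mu | (sumn tau <= sumn mu - a)%N)
    psum_part tau * qinv (sumn mu - a - sumn tau).
Proof.
move=> zmu le_a; rewrite /opD shift_up_psum_part // umbral_sum [RHS]big_mkcond /= !big_seq.
apply: eq_bigr => tau /subpartitions_sub/subseq_sumn le_tau.
rewrite umbralZ -['X^_](mulr1 'X^_) umbralXn /umbral size_poly1 big_ord1 coef1 eqxx mulr1 add0n.
rewrite /delay leq_subRL // leq_subRL // addnC subnAC.
by case: ifP => // _; rewrite mulr0.
Qed.

(** The last step of the recursion involves no choice: on constant terms, Q^-1
    acts as 1. *)
Lemma vac_opD a f : vac (opD shift_up qinv a f) = vac (shift_up f)`_a.
Proof.
have nv N : (a < N)%N -> \sum_(j < N) vac (delay a qinv j * (shift_up f)`_j) = vac (shift_up f)`_a.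
  move=> aN; rewrite (bigD1 (Ordinal aN)) //= [X in X + _](rmorphM vac) /delay leqnn subnn.
  rewrite vac_qinv mul1r big1 ?addr0 // => j /eqP nj; rewrite [LHS](rmorphM vac).
  case: leqP => aj; last by rewrite rmorph0 mul0r.
  rewrite vac_qinv; case: eqP => [d|_]; last exact: mul0r.
  case: nj; apply: val_inj => /=; lia.
rewrite /opD (umbral_wide _ (leq_maxl (size (shift_up f)) a.+1)) (rmorph_sum vac) nv //.
exact: leq_maxr.
Qed.

Lemma vac_shift_up_psum_part mu : 0%N \notin mu -> vac (shift_up (psum_part mu))`_(sumn mu) = 1.
Proof.
move=> zmu; have <- : (map_poly vac (shift_up (psum_part mu)))`_(sumn mu) = vac (shift_up (psum_part mu))`_(sumn mu).
  exact: coef_map.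
suff -> : map_poly vac (shift_up (psum_part mu)) = 'X^(sumn mu) by rewrite coefXn eqxx.
elim: mu zmu => [_|x mu IH].
  by rewrite /psum_part big_nil (rmorph1 shift_up) (rmorph1 (map_poly vac)).
rewrite inE negb_or eq_sym -lt0n => /andP[x0 zmu].
have -> : psum_part (x :: mu) = psum x * psum_part mu by apply: big_cons.
rewrite (rmorphM shift_up) (rmorphM (map_poly vac)) [X in _ * X](IH zmu) shift_up_psum // exprD.
congr (_ * _); rewrite (rmorphD (map_poly vac)) /= map_polyC map_polyXn /=.
by rewrite vac_psum // add0r.
Qed.

Lemma sum_pair_seqs_cons a b la nu (G : seq nat * seq nat -> Qt) : 
  \sum_(c <- pair_seqs [:: a, b & la] nu) \prod_(rt <- c) G rt =
  \sum_(tau <- subpartitions nu | (sumn tau <= sumn (b :: la))%N)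
   \sum_(rho <- partitions (sumn (b :: la) - sumn tau))
     G (rho, tau) * \sum_(c <- pair_seqs (b :: la) (part_union tau rho)) \prod_(rt <- c) G rt.
Proof.
rewrite [pair_seqs _ _]/= big_allpairs_dep big_filter; apply: eq_bigr => tau _.
rewrite big_allpairs_dep; apply: eq_bigr => rho _.
by rewrite mulr_sumr; apply: eq_bigr => c _; rewrite big_cons.
Qed.

Lemma pairing_cons a la f : pairing (a :: la) f = pairing la (opD shift_up qinv a f).
Proof. by []. Qed.

Lemma psum_part_union tau rho : psum_part (part_union tau rho) = psum_part tau * psum_part rho.
Proof. by rewrite /psum_part (perm_big _ (perm_part_union tau rho)) big_cat. Qed.

(** Each D peels off one part of la. On p_mu it gives a sum over subpartitions tau
    and over the partitions rho in the expansion of Q^-1, of multiples of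
    p_(tau cup rho): this is one step of the recursion that enumerates the
    sequences of pairs. *)
Lemma pairing_psum_part a la mu : 0%N \notin mu -> sumn (a :: la) = sumn mu ->
  pairing (a :: la) (psum_part mu) =
  \sum_(c <- pair_seqs (a :: la) mu) \prod_(rt <- c) ((-1) ^+ size rt.1 / zee_t rt.1).
Proof.
elim: la a mu => [|b la IH] a mu zmu sum_eq.
  rewrite pairing_cons [pair_seqs _ _]/= big_seq1 big_nil.
  move: sum_eq; rewrite /= addn0 => ->.
  by rewrite /pairing /opDs /= vac_opD vac_shift_up_psum_part.
have le_a : (a <= sumn mu)%N by rewrite -sum_eq leq_addr.
rewrite sum_pair_seqs_cons pairing_cons opD_psum_part // -sum_eq addKn.
rewrite pairing_sum big_seq_cond [RHS]big_seq_cond; apply: eq_bigr => tau /andP[sub_tau le_tau].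
have ztau : 0%N \notin tau.
  by apply: contra zmu; apply: mem_subseq (subpartitions_sub sub_tau) _.
rewrite qinv_partitions mulr_sumr pairing_sum !big_seq; apply: eq_bigr => rho.
rewrite mem_partitions => /andP[/andP[_ zrho] /eqP sum_rho].
rewrite -scalerAr pairingZ -psum_part_union IH //.
- by case/andP: (is_part_union ztau zrho).
- by rewrite (perm_sumn (perm_part_union tau rho)) sumn_cat sum_rho subnKC.
Qed.

Theorem theorem2p7 (X : seq nat -> seq nat -> Qt) (hX : is_green X)
    (n : nat) (hn : (1 <= n)%N) (la mu : seq nat)
    (hla : is_part_of n la) (hmu : is_part_of n mu) :
  X la mu =
    \sum_(c <- pair_seqs la mu)
      \prod_(rt <- c) ((-1) ^+ size rt.1 / zee_t rt.1).
Proof.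
rewrite (green_pairing hX hla hmu).
case/andP: hla hmu => _ /eqP sum_la /andP[/andP[_ zmu] /eqP sum_mu].
case: la sum_la => [|a la] sum_la; first by rewrite -sum_la in hn.
by rewrite pairing_psum_part // sum_mu.
Qed.
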